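(* Let $\rho_0\in L^1(\mathbb{T}^3)$ with $\rho_0\ge 0$ and let $\vec u_0=(u_0,v_0,w_0)\in L^\infty(\mathbb{T}^3)^3$. Let $\{\rho_{0,\epsilon},u_{0,\epsilon},v_{0,\epsilon},w_{0,\epsilon}\}_{\epsilon\in(0,1]}$ be families in $\mathcal{C}(\mathbb{T}^3)$ such that $\rho_{0,\epsilon}\ge\epsilon$ everywhere, $\|\rho_0-\rho_{0,\epsilon}\|_{L^1(\mathbb{T}^3)}\to0$, and $\|u_{0,\epsilon}-u_0\|_{L^\infty(\mathbb{T}^3)}$, $\|v_{0,\epsilon}-v_0\|_{L^\infty(\mathbb{T}^3)}$, $\|w_{0,\epsilon}-w_0\|_{L^\infty(\mathbb{T}^3)}\to0$ as $\epsilon\to0$. For each $\epsilon$ consider the system of ODEs in $\mathcal{C}(\mathbb{T}^3)^4$, with unknowns $\rho>0,\rho u,\rho v,\rho w$, consisting of the equations $$\begin{aligned}\frac{d\omega}{dt}(x,y,z,t,\epsilon)=\frac1\epsilon\big[&-(\omega(|u|+|v|+|w|))(x,y,z,t,\epsilon)\\&+(\omega u^+)(x-\epsilon,y,z,t,\epsilon)+(\omega u^-)(x+\epsilon,y,z,t,\epsilon)\\&+(\omega v^+)(x,y-\epsilon,z,t,\epsilon)+(\omega v^-)(x,y+\epsilon,z,t,\epsilon)\\&+(\omega w^+)(x,y,z-\epsilon,t,\epsilon)+(\omega w^-)(x,y,z+\epsilon,t,\epsilon)\big]\end{aligned}$$ for $\omega=\rho,\rho u,\rho v,\rho w$ successively,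 complemented by $$u=\frac{(\rho u)}{\rho},\quad v=\frac{(\rho v)}{\rho},\quad w=\frac{(\rho w)}{\rho},$$ with initial conditions $\rho_{0,\epsilon},\ \rho_{0,\epsilon}u_{0,\epsilon},\ \rho_{0,\epsilon}v_{0,\epsilon},\ \rho_{0,\epsilon}w_{0,\epsilon}$ at $t=0$. Then this system provides a weak asymptotic method of order $1$, global in space and in positive time, for the 3-D system of pressureless fluids $$\frac{\partial\rho}{\partial t}+\vec\nabla\cdot(\rho\vec u)=0,\qquad \frac{\partial}{\partial t}(\rho\vec u)+\vec\nabla\cdot(\rho\vec u\otimes\vec u)=\vec0,\qquad \vec u=(u,v,w).$$ That is, the system of ODEs has for each $\epsilon$ a solution defined for all $t\in[0,+\infty)$, and for every $\psi\in\mathcal{C}_c^\infty(\mathbb{R}^3)$, every $t\in[0,+\infty)$ and every $\omega\in\{\rho,\rho u,\rho v,\rho w\}$, as $\epsilon\to0^+$, $$\int_{\mathbb{R}^3}\Big(\frac{\partial\omega}{\partial t}\,\psi-\omega\,\vec u\cdot\vec\nabla\psi\Big)(x,y,z,t,\epsilon)\,dx\,dy\,dz=O(\epsilon).$$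
   Context: $\mathbb{T}^3=\mathbb{R}^3/(2\pi\mathbb{Z})^3$; functions on $\mathbb{T}^3$ are identified with functions on $\mathbb{R}^3$ that are $2\pi$-periodic in each variable. $\mathcal{C}(\mathbb{T}^3)$ is the Banach space of continuous real-valued functions on $\mathbb{T}^3$ with the sup norm. For a real function $f$, $f^+=\max(0,f)$ and $f^-=\max(0,-f)$. A solution of the ODE system on $[0,+\infty)$ is a continuously differentiable map $t\mapsto(\rho,\rho u,\rho v,\rho w)(\cdot,t,\epsilon)$ from $[0,+\infty)$ (right-hand derivative at $t=0$) to $\mathcal{C}(\mathbb{T}^3)^4$, with $\rho>0$. A weak asymptotic method for a system of PDEs is a family of functions, indexed by $\epsilon$ and differentiable in $t$, which satisfies the equations in the sense of distributions in the space variables, for each $t$, up to a remainder tending to $0$ as $\epsilon\to0^+$; it is of order $1$ if the remainder is $O(\epsilon)$ for each fixed test function. *)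

(* Defs.v *)
(* MathComp-Analysis *)
From HB Require Import structures.
From mathcomp Require Import all_boot all_order all_algebra.
From mathcomp Require Import all_classical all_reals all_analysis.
Set Implicit Arguments.
Unset Strict Implicit.
Unset Printing Implicit Defensive.
Import Order.TTheory GRing.Theory Num.Theory.
Import numFieldNormedType.Exports.
Local Open Scope classical_set_scope.
Local Open Scope ring_scope.

Notation space3 R := (R * R * R)%type.

Section torus.
Context (R : realType).
Implicit Types (f : space3 R -> R).

Definition axis (j : 'I_3) : space3 R :=
  ((j == 0 :> nat)%:R, (j == 1 :> nat)%:R, (j == 2 :> nat)%:R).

(* Functions on the torus are represented by their periodic lifts to R^3. *)
Definition periodic f : Prop :=
  forall j p, f (p + (2 * pi) *: axis j) = f p.

Definition C_torus f : Prop := continuous f /\ periodic f.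

(* The supremum is finite, hence meaningful, for f in C_torus. *)
Definition sup_norm f : R := sup (range (fun p => `|f p|)).

Local Notation mspace :=
  (measurableTypeR R * measurableTypeR R * measurableTypeR R)%type.

Definition lebesgue3 : {measure set mspace -> \bar R} :=
  ((@lebesgue_measure R \x @lebesgue_measure R) \x @lebesgue_measure R)%E.

Definition cell : set mspace :=
  `[0, 2 * pi[%classic `*` `[0, 2 * pi[%classic `*` `[0, 2 * pi[%classic.

Lemma measurable_cell : measurable cell.
Proof. by apply: measurableX; [apply: measurableX|]; exact: measurable_itv. Qed.

(* Lebesgue measure on the torus, as the restriction to a fundamental domain:
   for periodic functions, the norms of L^p(torus) are those of this measure. *)
Definition torus_measure : {measure set mspace -> \bar R} :=
  mrestr lebesgue3 measurable_cell.

Definition L_torus (q : \bar R) f : Prop :=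
  f \in Lfun torus_measure q /\ periodic f.

Definition L_torus_norm (q : \bar R) f : \bar R :=
  'N[torus_measure]_q [EFin \o f].

(* All iterated partial derivatives exist and are continuous. *)
Definition smooth f : Prop :=
  forall s : seq 'I_3,
    let g := foldr (fun j h => 'D_(axis j) h) f s in
    continuous g /\ forall j p, derivable g p (axis j).

Definition test_function f : Prop :=
  smooth f /\ compact (closure [set p | f p != 0]).

(* F is a C^1 map from [0, +oo[ to the Banach space C(torus), with derivative
   dF; at t = 0 the difference quotients are only taken for h > 0. *)
Definition C1_halfline (F dF : R -> space3 R -> R) : Prop :=
  forall t, 0 <= t ->
  [/\ C_torus (F t), C_torus (dF t),
      sup_norm (fun p => h^-1 * (F (t + h) p - F t p) - dF t p)
        @[h --> within [set h | 0 <= t + h] 0^'] --> 0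
    & sup_norm (fun p => dF s p - dF t p)
        @[s --> within [set s | 0 <= s] (nbhs t)] --> 0].

End torus.

Section pressureless.
Context (R : realType).
Implicit Types (S : 'I_4 -> space3 R -> R) (V : 'I_3 -> space3 R -> R).

(* A state S lists (rho, rho u, rho v, rho w), at the indices 0, 1, 2, 3. *)
Definition velocity S : 'I_3 -> space3 R -> R :=
  fun j p => S (lift ord0 j) p / S ord0 p.

Definition initial_state (r0 : space3 R -> R) (u0 : 'I_3 -> space3 R -> R) :
    'I_4 -> space3 R -> R :=
  fun k p => if unlift ord0 k is Some j then r0 p * u0 j p else r0 p.

Definition transport_rhs (eps : R) V (w : space3 R -> R) : space3 R -> R :=
  fun p => eps^-1 *
    (- (w p * \sum_(j < 3) `|V j p|) +
     \sum_(j < 3) ((w \* (V j)^\+) (p - eps *: axis R j) +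
                   (w \* (V j)^\-) (p + eps *: axis R j))).

(* U is a solution on [0, +oo[ with time derivative dU. *)
Definition ode_solution (eps : R) (S0 : 'I_4 -> space3 R -> R)
    (U dU : R -> 'I_4 -> space3 R -> R) : Prop :=
  [/\ forall k, C1_halfline (U ^~ k) (dU ^~ k),
      forall t p, 0 <= t -> 0 < U t ord0 p,
      forall t k p, 0 <= t ->
        dU t k p = transport_rhs eps (velocity (U t)) (U t k) p
    & forall k p, U 0 k p = S0 k p].

(* Weak form of d_t w + div (w V) = 0 at a given time, with dw for d_t w. *)
Definition weak_residual (dw w : space3 R -> R) V (psi : space3 R -> R) : R :=
  \int[lebesgue3 R]_p
    (dw p * psi p - w p * \sum_(j < 3) V j p * 'D_(axis R j) psi p).

(* The family (U eps) of states, with time derivatives dU eps, satisfies the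
   conservation laws d_t w + div (w velocity) = 0, w ranging over rho and the
   momentum components, in the sense of distributions in space up to
   O(eps), at each time t >= 0 and for each test function. *)
Definition weak_asymptotic_order1 (U dU : R -> R -> 'I_4 -> space3 R -> R) :
    Prop :=
  forall (psi : space3 R -> R) (t : R) (k : 'I_4), test_function psi -> 0 <= t ->
    (fun eps => weak_residual (dU eps t k) (U eps t k)
                  (velocity (U eps t)) psi)
    =O_ (0^'+) (fun eps : R => eps).

End pressureless.

(* Main.v *)
Require Import Defs.
From HB Require Import structures.
From mathcomp Require Import all_boot all_order all_algebra.
From mathcomp Require Import all_classical all_reals all_analysis.
From mathcomp Require Import ess_sup_inf measurable_realfun ring lra.
Set Implicit Arguments.
Unset Strict Implicit.
Unset Printing Implicit Defensive.
Import Order.TTheory GRing.Theory Num.Theory.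
Import numFieldNormedType.Exports.
Local Open Scope classical_set_scope.
Local Open Scope ring_scope.

(** For fixed eps the system is an ordinary differential equation S' = A S in
    C(torus)^4, where A involves the products w * (m / rho)^+ and
    w * (m / rho)^-, singular at rho = 0.  On the cone of states with
    |m| <= M rho these products are homogeneous of degree 1 and Lipschitz for
    the sup norm (ratio_lipschitz).  Composing A with a Lipschitz retraction
    onto the cone (clip) gives a globally Lipschitz field, which has a global
    solution by Picard iteration (lipschitz_ode_existence).

    That solution never leaves the cone.  A point loses its content at a rate at
    most lam = 3 M / eps, and what it receives from its neighbours is
    nonnegative, so A S = - lam S + gain S where gain S belongs to the cone
    (gain_cone).  Hence the functions rho, M rho + m and M rho - m, multiplied
    by exp (lam t), are nondecreasing in time: the density stays positive, the
    velocities stay bounded by M, the retraction acts as the identity and the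
    original system is solved (ode_solution_exists).  The system commutes with
    translations in space, so the stability of solutions transfers the
    periodicity and the modulus of continuity of the initial data to all times.

    For the consistency estimate, the right-hand side is a sum of differences
    f (p -+ eps a) - f p along the axes a, divided by eps (transport_rhsE).
    Tested against psi, the differences move to psi, because Lebesgue measure is
    invariant under translation; by the Taylor formula they cancel the flux term
    of the conservation law up to C eps^2 times the integral of |w| over a box
    containing the support of psi (residual_term_bound).  Since |w| <= M rho,
    and the box is covered by finitely many period cells, this integral is at
    most a constant times the mass of rho in one cell.  Differences of
    translates have integral 0 over a period, so this mass is constant in time
    (mass_conserved).  The residual is therefore at most
    K M^2 (mass of the initial density) eps, with K depending on psi only
    (weak_residual_bound).

    Finally M and the initial mass stay bounded as eps tends to 0: the mass by
    the convergence in L^1, and the velocities by the convergence in L^oo,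
    because the essential supremum of a continuous function is its supremum
    (sup_le_Linfty). *)

(** * Differential inequalities on the half-line *)

Section halfline_calculus.
Context (R : realType).
Implicit Types (f df g h dh : R -> R).

Lemma is_derive_continuous f (x df : R) :
  is_derive x 1 f df -> {for x, continuous f}.
Proof. by move=> [/derivable1_diffP/differentiable_continuous]. Qed.

(** Integrating from -1 puts 0 in the interior of the domain, so that the
    derivative at 0 is two-sided. *)
Lemma continuous_antiderivative g : continuous g ->
  exists2 G : R -> R, G 0 = 0 & forall x : R, 0 <= x -> is_derive x 1 G (g x).
Proof.
move=> cg.
pose F (x : R) : R := (\int[lebesgue_measure]_(t in `[-1, x]) g t)%R.
exists (fun x => F x - F 0) => [|x x0]; first by rewrite subrr.
have [dF F'] : derivable F x 1 /\ derive1 F x = g x.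
  apply: (@continuous_FTC1_closed _ g (-1) x (x + 1)).
  - by lra.
  - apply: continuous_compact_integrable; first exact: segment_compact.
    exact/continuous_subspaceT.
  - by lra.
  - exact: cg.
have : is_derive x 1 (F - cst (F 0)) (g x - 0).
  apply: is_deriveB; apply: DeriveDef => //.
  by rewrite -derive1E.
by rewrite subr0.
Qed.

Lemma MVT_halfline f df (a b : R) : 0 <= a -> a <= b ->
  (forall x : R, 0 <= x -> is_derive x 1 f (df x)) ->
  exists2 c, a <= c <= b & f b - f a = df c * (b - a).
Proof.
move=> a0 ab fd.
have [c] : exists2 c, c \in `[a, b]%R & f b - f a = df c * (b - a).
  apply: MVT_segment => // [x|].
    by rewrite in_itv /= => /andP[ax _]; apply: fd; lra.
  apply: continuous_in_subspaceT => x; rewrite inE /= in_itv /= => /andP[ax _].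
  by apply: (is_derive_continuous (fd x _)); lra.
by rewrite in_itv; exists c.
Qed.

Lemma le_increment f df h dh (a b : R) : 0 <= a -> a <= b ->
  (forall x : R, 0 <= x -> is_derive x 1 f (df x)) ->
  (forall x : R, 0 <= x -> is_derive x 1 h (dh x)) ->
  (forall x, 0 <= x -> df x <= dh x) -> f b - f a <= h b - h a.
Proof.
move=> a0 ab fd hd fh.
have [|c /andP[ac _]] := @MVT_halfline (h - f) (fun x => dh x - df x) a b a0 ab.
  by move=> x x0; apply: is_deriveB; [exact: hd|exact: fd].
move=> E; have {}E : (h b - f b) - (h a - f a) = (dh c - df c) * (b - a) := E.
have : 0 <= (dh c - df c) * (b - a).
  by rewrite mulr_ge0 ?subr_ge0// fh//; lra.
by rewrite -E; lra.
Qed.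

(** Integral inequalities on the iterates below all take this form: the
    derivative is compared with that of an explicit majorant. *)
Lemma le_normr_increment f df h dh (a b : R) : 0 <= a -> a <= b ->
  (forall x : R, 0 <= x -> is_derive x 1 f (df x)) ->
  (forall x : R, 0 <= x -> is_derive x 1 h (dh x)) ->
  (forall x, 0 <= x -> `|df x| <= dh x) -> `|f b - f a| <= h b - h a.
Proof.
move=> a0 ab fd hd fh; rewrite ler_norml; apply/andP; split; last first.
  apply: (le_increment a0 ab fd hd) => x x0.
  exact: le_trans (ler_norm _) (fh _ x0).
rewrite lerNl.
have := @le_increment (- f) (fun x => - df x) h dh a b a0 ab _ hd.
rewrite /(- f) /= opprK opprB addrC; apply => x x0.
  by apply: is_deriveN; exact: fd.
by apply: le_trans (fh _ x0); rewrite -normrN ler_norm.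
Qed.

End halfline_calculus.

(** * Limits at a geometric rate *)
Section geometric.
Context (R : realType).

Lemma le_geometric (x a K : R) : (forall n, x <= a + K * 2^-1 ^+ n) -> x <= a.
Proof.
move=> H.
have : (fun n => a + K * 2^-1 ^+ n) @ \oo --> a + K * 0.
  apply: cvgD; first exact: cvg_cst.
  apply: cvgM; first exact: cvg_cst.
  by apply: cvg_expr; rewrite ger0_norm ?invr_ge0//; lra.
rewrite mulr0 addr0 => cv; rewrite -(cvg_lim _ cv)//.
apply: limr_ge; first by apply/cvg_ex; exists a.
by apply: nearW.
Qed.

(** The numbers u n - 2 K / 2^n are nondecreasing and bounded, and the limit is
    their supremum. *)
Lemma geometric_cauchy (u : nat -> R) (K : R) :
  (forall n, `|u n.+1 - u n| <= K * 2^-1 ^+ n) ->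
  exists l, forall n, `|u n - l| <= 2 * K * 2^-1 ^+ n.
Proof.
move=> H.
pose e n : R := 2 * K * 2^-1 ^+ n.
have eS n : K * 2^-1 ^+ n = e n - e n.+1 by rewrite /e exprS; field.
have e0 n : 0 <= e n.
  have := le_trans (normr_ge0 _) (H n); rewrite /e => ?.
  by rewrite -mulrA mulr_ge0.
have up n k : `|u (n + k)%N - u n| <= e n - e (n + k)%N.
  elim: k => [|k IH]; first by rewrite addn0 !subrr normr0.
  rewrite addnS.
  have := H (n + k)%N; rewrite eS => ?.
  have := ler_distD (u (n + k)%N) (u (n + k).+1) (u n); lra.
have nm n m : u n - e n <= u m + e m.
  case: (leqP n m) => [/subnKC <-|/ltnW /subnKC <-].
    have := up n (m - n)%N; rewrite ler_norml => /andP[+ _].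
    have := e0 (n + (m - n))%N; lra.
  have := up m (n - m)%N; rewrite ler_norml => /andP[_ +].
  have := e0 (m + (n - m))%N; lra.
pose S := range (fun n => u n - e n).
have S0 : S !=set0 by exists (u 0%N - e 0%N), 0%N.
exists (sup S) => n; rewrite ler_distl; apply/andP; split.
- rewrite lerBlDr; apply: ge_sup => // _ [m _ <-]; exact: nm.
- rewrite -lerBlDr; apply: ub_le_sup; last by exists n.
  by exists (u 0%N + e 0%N) => _ [m _ <-]; exact: nm.
Qed.

End geometric.

(** * Equations with a field that is Lipschitz for the sup norm *)

(** The points of P index the unknowns.  With the weight E t = exp (2 L t), the
    Picard map is a contraction of ratio 1/2 on the whole half-line: an error
    D * E enters the field as L * D * E, whose integral is at most D * E / 2. *)
Section lipschitz_ode.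
Context (R : realType) (P : Type) (A : (P -> R) -> P -> R) (L : R).
Context (L_gt0 : 0 < L).
Context (A_lip : forall f g (D : R), (forall p, `|f p - g p| <= D) ->
  forall p, `|A f p - A g p| <= L * D).

Let E (t : R) : R := expR (2 * L * t).

Let E_gt0 t : 0 < E t. Proof. exact: expR_gt0. Qed.

Let E0 : E 0 = 1. Proof. by rewrite /E mulr0 expR0. Qed.

Let E_le s t : s <= t -> E s <= E t.
Proof. by move=> st; rewrite ler_expR ler_wpM2l// mulr_ge0// ltW. Qed.

Let dE (c t : R) : is_derive t 1 (fun s => c * E s) (2 * L * c * E t).
Proof.
have -> : (fun s => c * E s) = c \*: (expR \o (fun s => 2 * L * s)) by [].
apply: is_derive_eq.
rewrite /= /GRing.scale /= !mulr1 /E; ring.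
Qed.

Let E_continuous : continuous E.
Proof.
move=> t; have := is_derive_continuous (dE 1 t).
by rewrite (_ : (fun s => 1 * E s) = E)//; apply/funext => s; rewrite mul1r.
Qed.

(** A modulus of continuity in time, uniform over P, that the Picard map and
    pointwise limits preserve. *)
Definition exp_growth (C : R) (y : R -> P -> R) :=
  forall s t p, 0 <= s -> s <= t -> `|y t p - y s p| <= C * (E t - E s).

Lemma exp_growth_continuous (C : R) (y : R -> P -> R) (t e : R) :
  exp_growth C y -> 0 <= t -> 0 < e ->
  \forall s \near t, 0 <= s -> forall p, `|y s p - y t p| <= e.
Proof.
move=> yC t0 e0.
have C1 : 0 < `|C| + 1 by rewrite ltr_wpDl.
have := E_continuous (x := t).
move=> /cvgrPdist_le /(_ (e / (`|C| + 1)) (divr_gt0 e0 C1)).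
apply: filterS => s.
rewrite ler_pdivlMr// mulrC => Es s0 p.
apply: le_trans Es.
have le1 : `|C| * `|E t - E s| <= (`|C| + 1) * `|E t - E s|.
  by apply: ler_wpM2r => //; lra.
apply: le_trans le1; rewrite -normrM.
have [st|ts] := leP s t.
  by rewrite distrC; apply: le_trans (yC _ _ _ s0 st) (ler_norm _).
rewrite -(normrN (C * _)) -mulrN opprB.
by apply: le_trans (yC _ _ _ t0 (ltW ts)) (ler_norm _).
Qed.

Section existence.
Context (y0 : P -> R) (C : R) (A_y0 : forall p, `|A y0 p| <= L * C).

Let C_ge0 (p : P) : 0 <= C.
Proof. by have := le_trans (normr_ge0 _) (A_y0 p); rewrite pmulr_rge0. Qed.

(** The field is evaluated at the time max s 0, to be continuous on the whole
    line. *)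
Lemma picard_step (y : R -> P -> R) : exp_growth C y -> y 0 = y0 ->
  exists z : R -> P -> R, [/\ exp_growth C z, z 0 = y0 &
    forall (t : R) p, 0 <= t -> is_derive t 1 (z ^~ p) (A (y t) p)].
Proof.
move=> yC y00.
have cont p : continuous (fun s : R => A (y (Num.max s 0)) p).
  move=> t; apply/cvgrPdist_le => e e0.
  have cm : {for t, continuous ((@idfun R) \max (cst 0 : R -> R))}.
    by apply: continuous_max; [exact: cvg_id|exact: cvg_cst].
  have t'0 : 0 <= Num.max t 0 by rewrite le_max lexx orbT.
  have : \forall s \near t, 0 <= Num.max s 0 ->
      forall q, `|y (Num.max s 0) q - y (Num.max t 0) q| <= e / L.
    exact: (cm _ (exp_growth_continuous yC t'0 (divr_gt0 e0 L_gt0))).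
  apply: filterS => s ys.
  apply: le_trans (_ : L * (e / L) <= e); last first.
    by rewrite mulrCA divff ?mulr1// gt_eqF.
  apply: A_lip => q; rewrite distrC; apply: ys.
  by rewrite le_max lexx orbT.
have /choice[G /all_and2[G0 dG]] : forall p, exists G : R -> R, G 0 = 0 /\
    forall x : R, 0 <= x -> is_derive x 1 G (A (y (Num.max x 0)) p).
  by move=> p; have [G ? ?] := continuous_antiderivative (cont p); exists G.
exists (fun t p => y0 p + G p t).
have dz (t : R) p : 0 <= t -> is_derive t 1 (fun t => y0 p + G p t) (A (y t) p).
  move=> t0; have := dG p t t0; rewrite max_l// => Gd.
  by rewrite -[A _ _]add0r; exact: is_deriveD.
split=> //; last by apply/funext => p; rewrite G0 addr0.
move=> s t p s0 st; rewrite mulrBr.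
apply: (le_normr_increment s0 st (dz ^~ p) (fun x _ => dE C x)) => x x0.
have -> : A (y x) p = A (y x) p - A y0 p + A y0 p by rewrite subrK.
have C0 := C_ge0 p.
apply: le_trans (_ : L * (C * (E x - 1)) + L * C <= _).
  apply: le_trans (ler_normD _ _) _; apply: lerD => //.
  apply: A_lip => q; rewrite -y00 -E0; exact: yC.
have -> : L * (C * (E x - 1)) + L * C = (L * C) * E x by ring.
apply: ler_wpM2r; first exact: ltW.
have : 0 <= L * C by rewrite mulr_ge0// ltW.
lra.
Qed.

(** Successive iterates differ by at most C * E t / 2^n, hence converge.  The
    image of the limit by one more step is as close to the iterates, so it is
    equal to the limit on the half-line, and it is differentiable. *)
Theorem lipschitz_ode_existence :
  exists y : R -> P -> R, [/\ exp_growth C y, y 0 = y0 &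
    forall (t : R) p, 0 <= t -> is_derive t 1 (y ^~ p) (A (y t) p)].
Proof.
have /choice[next nextP] : forall y, exists z : R -> P -> R,
    exp_growth C y /\ y 0 = y0 ->
    [/\ exp_growth C z, z 0 = y0 &
      forall (t : R) p, 0 <= t -> is_derive t 1 (z ^~ p) (A (y t) p)].
  move=> y; have [[yC y00]|nyC] := pselect (exp_growth C y /\ y 0 = y0).
    by have [z zP] := picard_step yC y00; exists z.
  by exists y => /nyC.
pose y n := iter n next (fun=> y0).
have yP n : exp_growth C (y n) /\ y n 0 = y0.
  elim: n => [|n /nextP[]//]; split => // s t p s0 st.
  rewrite subrr normr0 mulr_ge0 ?C_ge0//.
  by rewrite subr_ge0 E_le.
have dy n (t : R) p : 0 <= t -> is_derive t 1 (y n.+1 ^~ p) (A (y n t) p).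
  by move: t p; have [] := nextP _ (yP n).
have y0E n p : y n 0 p = y0 p by rewrite (yP n).2.
have gap n t p : 0 <= t -> `|y n.+1 t p - y n t p| <= C * E t * 2^-1 ^+ n.
  elim: n t p => [|n IH] t p t0.
    have := (yP 1%N).1 0 t p (lexx _) t0.
    rewrite y0E E0 expr0 mulr1 => H; apply: le_trans H _.
    by apply: ler_wpM2l; [exact: C_ge0|lra].
  pose c := C * 2^-1 ^+ n.+1.
  have c0 : 0 <= c by rewrite mulr_ge0 ?exprn_ge0 ?(C_ge0 p)//; lra.
  have : `|(y n.+2 t p - y n.+1 t p) - (y n.+2 0 p - y n.+1 0 p)| <=
      c * E t - c * E 0.
    apply: (@le_normr_increment _ (fun t => y n.+2 t p - y n.+1 t p)
      (fun t => A (y n.+1 t) p - A (y n t) p) _ _ 0 t (lexx _) t0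
      (fun x x0 => is_deriveB (dy n.+1 x p x0) (dy n x p x0))
      (fun x _ => dE c x)) => x x0.
    apply: le_trans (A_lip (fun q => IH x q x0) p) _.
    by rewrite /c exprS le_eqVlt; apply/orP; left; apply/eqP; field.
  rewrite !y0E !subrr subr0 E0 mulr1 => /le_trans; apply.
  by rewrite -[_ * E t * _]mulrAC -/c; lra.
have /choice[ylim ylimP] : forall t, exists f : P -> R, 0 <= t ->
    forall p n, `|y n t p - f p| <= 2 * (C * E t) * 2^-1 ^+ n.
  move=> t; have [t0|] := boolP (0 <= t); last by exists y0.
  have /choice[f fP] : forall p, exists l,
      forall n, `|y n t p - l| <= 2 * (C * E t) * 2^-1 ^+ n.
    by move=> p; apply: geometric_cauchy => n; exact: gap.
  by exists f.
have ylim0 : ylim 0 = y0.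
  apply/funext => p; apply/eqP; rewrite -subr_eq0 -normr_le0.
  apply: (@le_geometric _ _ _ (2 * (C * E 0))) => n.
  by rewrite add0r distrC -(y0E n); exact: ylimP.
have ylimC : exp_growth C ylim.
  move=> s t p s0 st.
  apply: (@le_geometric _ _ _ (2 * (C * E t) + 2 * (C * E s))) => n.
  have t0 := le_trans s0 st.
  have := ylimP _ t0 p n; have := ylimP _ s0 p n.
  have := (yP n).1 s t p s0 st.
  rewrite !ler_norml mulrDl; lra.
have [z [zC z0 dz]] := picard_step ylimC ylim0.
suff zE t : 0 <= t -> z t = ylim t.
  by exists z; split => // t p t0; rewrite zE//; exact: dz.
move=> t0; apply/funext => p; apply/eqP; rewrite -subr_eq0 -normr_le0.
apply: (@le_geometric _ _ _ (2 * (C * E t))) => n; rewrite add0r.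
pose c := C * 2^-1 ^+ n.
have c0 : 0 <= c by rewrite mulr_ge0 ?exprn_ge0 ?(C_ge0 p)//; lra.
have : `|(z t p - y n.+1 t p) - (z 0 p - y n.+1 0 p)| <= c * E t - c * E 0.
  apply: (@le_normr_increment _ (fun t => z t p - y n.+1 t p)
    (fun t => A (ylim t) p - A (y n t) p) _ _ 0 t (lexx _) t0
    (fun x x0 => is_deriveB (dz x p x0) (dy n x p x0))
    (fun x _ => dE c x)) => x x0.
  rewrite distrC.
  apply: le_trans (A_lip (fun q => ylimP x x0 q n) p) _.
  by rewrite /c le_eqVlt; apply/orP; left; apply/eqP; ring.
rewrite y0E z0 subrr subr0 E0 mulr1 => H.
have {}H : `|z t p - y n.+1 t p| <= c * E t by apply: le_trans H _; lra.
have := ylimP _ t0 p n.+1.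
have -> : 2 * (C * E t) * 2^-1 ^+ n.+1 = c * E t by rewrite /c exprS; field.
have -> : 2 * (C * E t) * 2^-1 ^+ n = 2 * (c * E t) by rewrite /c; ring.
move: H; rewrite !ler_norml; lra.
Qed.

End existence.

(** The growth of both solutions gives a first bound of the form K * E.  Each
    integration of the equation halves the part of the bound that does not come
    from D, and this part disappears in the limit. *)
Theorem lipschitz_ode_stability (y z : R -> P -> R) (Cy Cz D : R) :
  exp_growth Cy y -> exp_growth Cz z ->
  (forall (t : R) p, 0 <= t -> is_derive t 1 (y ^~ p) (A (y t) p)) ->
  (forall (t : R) p, 0 <= t -> is_derive t 1 (z ^~ p) (A (z t) p)) ->
  (forall p, `|y 0 p - z 0 p| <= D) ->
  forall t p, 0 <= t -> `|y t p - z t p| <= 2 * D * E t.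
Proof.
move=> yC zC dy dz D0 t p t0.
have D_ge0 : 0 <= D by exact: le_trans (D0 p).
pose K := `|Cy| + `|Cz|.
have K0 : 0 <= K by rewrite addr_ge0.
have bnd n x q : 0 <= x ->
    `|y x q - z x q| <= (2 * D + K * 2^-1 ^+ n) * E x.
  elim: n x q => [|n IH] x q x0.
    have := yC 0 x q (lexx _) x0; have := zC 0 x q (lexx _) x0; have := D0 q.
    have E1 : 0 <= E x - 1 by rewrite -E0 subr_ge0 E_le.
    rewrite E0 expr0 mulr1 => h1 h2 h3.
    have h2' := le_trans h2 (ler_wpM2r E1 (ler_norm _)).
    have h3' := le_trans h3 (ler_wpM2r E1 (ler_norm _)).
    have : D <= D * E x by apply: ler_peMr => //; lra.
    have : 0 <= D * E x by apply: mulr_ge0 => //; lra.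
    rewrite /K.
    have : `|y x q - z x q| <= D + K * (E x - 1).
      move: h1 h2' h3'; rewrite /K !ler_norml mulrDl; lra.
    rewrite /K; have := normr_ge0 Cy; have := normr_ge0 Cz; nra.
  pose c := D + K * 2^-1 ^+ n.+1.
  have H : `|(y x q - z x q) - (y 0 q - z 0 q)| <= c * E x - c * E 0.
    apply: (@le_normr_increment _ (fun t => y t q - z t q)
      (fun t => A (y t) q - A (z t) q) _ _ 0 x (lexx _) x0
      (fun x x0 => is_deriveB (dy x q x0) (dz x q x0))
      (fun x _ => dE c x)) => s s0.
    apply: le_trans (A_lip (fun r => IH s r s0) q) _.
    by rewrite /c exprS le_eqVlt; apply/orP; left; apply/eqP; field.
  rewrite E0 mulr1 in H.
  have Dc : D <= c.
    have : 0 <= K * 2^-1 ^+ n.+1 by rewrite mulr_ge0// exprn_ge0//; lra.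
    by rewrite /c; lra.
  have -> : (2 * D + K * 2^-1 ^+ n.+1) * E x = c * E x + D * E x.
    by rewrite /c; ring.
  have : 0 <= D * E x by apply: mulr_ge0; last exact: ltW.
  have := D0 q; move: H; rewrite !ler_norml; lra.
apply: (@le_geometric _ _ _ (K * E t)) => n.
have := bnd n t p t0.
by rewrite mulrDl [K * _ * _]mulrAC.
Qed.

End lipschitz_ode.

(** * Continuous functions on the torus *)
Section torus_functions.
Context (R : realType).
Implicit Types (f g : space3 R -> R) (p q : space3 R).

Definition lattice (k1 k2 k3 : int) : space3 R :=
  (k1%:~R * (2 * pi), k2%:~R * (2 * pi), k3%:~R * (2 * pi)).

Lemma periodic_axis f (j : 'I_3) (z : int) p : Defs.periodic f ->
  f (p + (z%:~R * (2 * pi)) *: axis R j) = f p.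
Proof.
move=> fper.
have up (n : nat) q : f (q + (n%:R * (2 * pi)) *: axis R j) = f q.
  elim: n => [|n IH]; first by rewrite mul0r scale0r addr0.
  by rewrite -natr1 mulrDl mul1r scalerDl addrA fper.
case: z => n; first exact: up.
rewrite NegzE mulrNz mulNr scaleNr.
rewrite -[LHS](up n.+1) -addrA addNr addr0//.
Qed.

Lemma latticeE (k1 k2 k3 : int) : lattice k1 k2 k3 =
  (k1%:~R * (2 * pi)) *: axis R (inord 0) +
  (k2%:~R * (2 * pi)) *: axis R (inord 1) +
  (k3%:~R * (2 * pi)) *: axis R (inord 2).
Proof.
rewrite /axis !inordK//= /lattice; congr (_, _, _) => /=.
all: rewrite ?scaler0 ?addr0 ?add0r; exact/esym/mulr1.
Qed.

Lemma periodic_lattice f k1 k2 k3 p : Defs.periodic f ->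
  f (p + lattice k1 k2 k3) = f p.
Proof. by move=> fper; rewrite latticeE !addrA !periodic_axis. Qed.

Lemma pi2_gt0 : 0 < 2 * pi :> R.
Proof. by rewrite mulr_gt0// pi_gt0. Qed.

Lemma cell_lattice p : exists k1 k2 k3, @cell R (p + lattice k1 k2 k3).
Proof.
have red (x : R) : exists k : int, 0 <= x + k%:~R * (2 * pi) < 2 * pi.
  exists (- Num.floor (x / (2 * pi))).
  have := floor_itv (x / (2 * pi)).
  rewrite intrD1 ler_pdivlMr ?ltr_pdivrMr ?pi2_gt0// mulrNz mulNr mulrDl; lra.
case: p => [[x y] z].
have [k1 h1] := red x; have [k2 h2] := red y; have [k3 h3] := red z.
exists k1, k2, k3; rewrite /cell /=.
by split; [split|] => /=; rewrite in_itv.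
Qed.

Lemma periodic_cell f p : Defs.periodic f -> exists2 q, @cell R q & f p = f q.
Proof.
move=> fper; have [k1 [k2 [k3 cq]]] := cell_lattice p.
by exists (p + lattice k1 k2 k3) => //; rewrite periodic_lattice.
Qed.

Definition cube (a b : R) : set (space3 R) :=
  `[a, b]%classic `*` `[a, b]%classic `*` `[a, b]%classic.

Lemma compact_cube (a b : R) : compact (cube a b).
Proof. by do 2 ?apply: compact_setX; exact: segment_compact. Qed.

Lemma cell_cube : @cell R `<=` cube 0 (2 * pi).
Proof.
move=> [[x y] z] [[/=]]; rewrite !in_itv /= => /andP[? ?] /andP[? ?] /andP[? ?].
by split; [split|] => /=; rewrite in_itv /=; apply/andP; split => //; exact: ltW.
Qed.

Lemma compact_continuous_bounded f (K : set (space3 R)) :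
  compact K -> continuous f -> exists M, forall p, K p -> `|f p| <= M.
Proof.
move=> cK cf.
have /compact_bounded[M [_ MP]] : compact (f @` K).
  by apply: continuous_compact => //; exact: continuous_subspaceT.
exists (M + 1) => p Kp; apply: MP; first by lra.
by exists p.
Qed.

Lemma C_torus_bounded f : C_torus f -> exists M, forall p, `|f p| <= M.
Proof.
move=> [cf fper].
have [M MP] := compact_continuous_bounded (@compact_cube 0 (2 * pi)) cf.
by exists M => p; have [q /cell_cube cq ->] := periodic_cell p fper; exact: MP.
Qed.

(** Heine's theorem, in terms of translations because these commute with the
    system. *)
Lemma compact_unif_continuous f (K : set (space3 R)) (e : R) :
  compact K -> continuous f -> 0 < e ->
  \forall a \near (0 : space3 R), forall p, K p -> `|f (p + a) - f p| <= e.
Proof.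
move=> /compact_near_coveringP cK cf e0.
apply: (cK _ (nbhs (0 : space3 R)) (fun a p => `|f (p + a) - f p| <= e)) => p _.
have /cvgrPdist_le/(_ _ (divr_gt0 e0 (ltr0Sn _ 1))) near_p :
  f x @[x --> p] --> f p by exact: cf.
pose F := filter_prod (nbhs (p : space3 R)) (nbhs (0 : space3 R)).
have fst_p : z.1 @[z --> F] --> (p : space3 R) by exact: cvg_fst.
have snd_0 : z.2 @[z --> F] --> (0 : space3 R) by exact: cvg_snd.
have add_p : z.1 + z.2 @[z --> F] --> (p : space3 R).
  by rewrite -[X in _ --> X]addr0; exact: cvgD fst_p snd_0.
have h1 : \forall z \near F, `|f p - f (z.1 + z.2)| <= e / 2.
  exact: (add_p _ near_p).
have h2 : \forall z \near F, `|f p - f z.1| <= e / 2 := fst_p _ near_p.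
suff : \forall z \near F, `|f (z.1 + z.2) - f z.1| <= e by [].
apply: filterS2 h1 h2 => z.
by rewrite !ler_norml; lra.
Qed.

Lemma C_torus_unif_continuous f (e : R) : C_torus f -> 0 < e ->
  \forall a \near (0 : space3 R), forall p, `|f (p + a) - f p| <= e.
Proof.
move=> [cf fper] e0.
have := compact_unif_continuous (@compact_cube 0 (2 * pi)) cf e0.
apply: filterS => a H p.
have [k1 [k2 [k3 /cell_cube/H]]] := cell_lattice p.
by rewrite addrAC !periodic_lattice.
Qed.

Lemma continuous_shift (f : space3 R -> R) (a : space3 R) : continuous f ->
  continuous (fun p : space3 R => f (p + a)).
Proof.
move=> cf p; apply: continuous_comp; last exact: cf.
by apply: cvgD; [exact: cvg_id|exact: cvg_cst].
Qed.

Lemma C_torus_shift f (a : space3 R) : C_torus f ->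
  C_torus (fun p => f (p + a)).
Proof.
move=> [cf fper]; split; first exact: continuous_shift.
by move=> k p; rewrite addrAC fper.
Qed.

Lemma sup_norm_le f (M : R) : (forall p, `|f p| <= M) -> sup_norm f <= M.
Proof.
by move=> fM; apply: ge_sup => [|_ [p _ <-]//]; exists `|f 0|; exists 0.
Qed.

Lemma le_sup_norm f p :
  (exists M, forall q, `|f q| <= M) -> `|f p| <= sup_norm f.
Proof.
move=> [M fM]; apply: ub_le_sup; last by exists p.
by exists M => _ [q _ <-].
Qed.

(** For an unbounded f the supremum is 0 by convention. *)
Lemma sup_norm_ge0 f : 0 <= sup_norm f.
Proof.
have [[M fM]|nb] := pselect (exists M, forall q, `|f q| <= M).
  by apply: le_trans (normr_ge0 (f 0)) _; apply: le_sup_norm; exists M.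
rewrite /sup_norm sup_out// => -[_ [M fM]]; apply: nb.
by exists M => q; apply: fM; exists q.
Qed.

Lemma sup_norm_cvg0 (T : Type) (F : set_system T) (FF : Filter F)
    (f : T -> space3 R -> R) :
  (forall e : R, 0 < e -> \forall t \near F, forall p, `|f t p| <= e) ->
  sup_norm (f t) @[t --> F] --> 0.
Proof.
move=> H; apply/cvgrPdist_le => e /H; apply: filterS => t ft.
by rewrite sub0r normrN ger0_norm ?sup_norm_ge0//; exact: sup_norm_le.
Qed.

End torus_functions.

(** * The transport operator on the cone of states *)
Section transport.
Context (R : realType).
Implicit Types (S : 'I_4 -> space3 R -> R) (V : 'I_3 -> space3 R -> R).

(** The loss |V| = V^+ + V^- balances what the neighbours receive, so the
    right-hand side is a sum of differences of translates. *)
Lemma transport_rhsE (eps : R) V w p : transport_rhs eps V w p =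
  eps^-1 * \sum_(j < 3)
    (((w \* (V j)^\+) (p - eps *: axis R j) - (w \* (V j)^\+) p) +
     ((w \* (V j)^\-) (p + eps *: axis R j) - (w \* (V j)^\-) p)).
Proof.
rewrite /transport_rhs; congr (_ * _).
rewrite mulr_sumr -sumrN -big_split /=; apply: eq_bigr => j _.
have -> : `|V j p| = (V j)^\+ p + (V j)^\- p.
  by have /(congr1 (@^~ p)) /= <- := funrposDneg (V j).
rewrite /=; ring.
Qed.

Lemma transport_rhsD (eps a : R) V (w1 w2 : space3 R -> R) p :
  transport_rhs eps V (fun q => a * w1 q + w2 q) p =
  a * transport_rhs eps V w1 p + transport_rhs eps V w2 p.
Proof.
rewrite !transport_rhsE mulrCA -mulrDr; congr (_ * _).
rewrite mulr_sumr -big_split /=; apply: eq_bigr => j _; ring.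
Qed.

(** Losses occur at a rate at most 3 M / eps and gains are nonnegative. *)
Lemma transport_rhs_ge (eps M : R) V w p : 0 < eps ->
  (forall j q, `|V j q| <= M) -> (forall q, 0 <= w q) ->
  0 <= 3 * M / eps * w p + transport_rhs eps V w p.
Proof.
move=> eps0 VM w0; rewrite /transport_rhs.
have -> : 3 * M / eps * w p = eps^-1 * (3 * M * w p) by ring.
rewrite -mulrDr mulr_ge0 ?invr_ge0 ?(ltW eps0)// addrA.
apply: addr_ge0; last first.
  apply: sumr_ge0 => j _ /=.
  by rewrite addr_ge0// mulr_ge0// ?funrpos_ge0 ?funrneg_ge0.
have : \sum_(j < 3) `|V j p| <= 3 * M.
  by rewrite !big_ord_recr big_ord0 /= add0r; have := VM; move=> /(_ _ p) H;
    apply: le_trans (lerD (lerD (H _) (H _)) (H _)) _; lra.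
move=> /(ler_wpM2l (w0 p)); lra.
Qed.

(** The bound ranges over the index 0 as well, where it holds because 1 <= M in
    all uses: density and momenta are treated alike. *)
Definition cone (M : R) S :=
  (forall p, 0 <= S ord0 p) /\ forall k p, `|S k p| <= M * S ord0 p.

(** A Lipschitz retraction onto the cone. *)
Definition clip (M : R) S : 'I_4 -> space3 R -> R := fun k p =>
  let r := Num.max (S ord0 p) 0 in
  if k == ord0 then r else Num.max (- (M * r)) (Num.min (S k p) (M * r)).

Lemma clip_cone (M : R) S : 1 <= M -> cone M (clip M S).
Proof.
move=> M1.
have r0 p : 0 <= Num.max (S ord0 p) 0 by rewrite le_max lexx orbT.
split => [p|k p]; rewrite /clip eqxx//.
case: ifP => _; first by rewrite ger0_norm// ler_peMl.
have := r0 p; set r := Num.max _ 0 => r0'.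
have Mr0 : 0 <= M * r by rewrite mulr_ge0//; lra.
rewrite ler_norml le_max lexx /= ge_max; apply/andP; split; first by lra.
by rewrite ge_min lexx orbT.
Qed.

Lemma clip_id (M : R) S k p : cone M S -> clip M S k p = S k p.
Proof.
move=> [S0 SM]; rewrite /clip max_l//; case: eqP => [->//|_].
have := SM k p; rewrite ler_norml => /andP[h1 h2].
by rewrite min_l// max_r.
Qed.

Lemma ler_dist_max (a a' b b' D : R) : `|a - a'| <= D -> `|b - b'| <= D ->
  `|Num.max a b - Num.max a' b'| <= D.
Proof.
rewrite !ler_norml.
by case: (leP a b) => ?; case: (leP a' b') => ? /andP[? ?] /andP[? ?];
  apply/andP; split; lra.
Qed.

Lemma ler_dist_min (a a' b b' D : R) : `|a - a'| <= D -> `|b - b'| <= D ->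
  `|Num.min a b - Num.min a' b'| <= D.
Proof.
rewrite !ler_norml.
by case: (leP a b) => ?; case: (leP a' b') => ? /andP[? ?] /andP[? ?];
  apply/andP; split; lra.
Qed.

Lemma clip_lipschitz (M D : R) S S' : 1 <= M ->
  (forall k p, `|S k p - S' k p| <= D) ->
  forall k p, `|clip M S k p - clip M S' k p| <= M * D.
Proof.
move=> M1 SD k p.
have D0 : 0 <= D by exact: le_trans (SD ord0 p).
have DM : D <= M * D by rewrite ler_peMl.
have r_lip : `|Num.max (S ord0 p) 0 - Num.max (S' ord0 p) 0| <= D.
  by apply: ler_dist_max => //; rewrite subrr normr0.
have Mr_lip : `|M * Num.max (S ord0 p) 0 - M * Num.max (S' ord0 p) 0| <= M * D.
  by rewrite -mulrBr normrM ger0_norm ?ler_wpM2l//; lra.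
rewrite /clip; case: ifP => _; first by lra.
apply: ler_dist_max; last by apply: ler_dist_min => //; apply: le_trans DM.
by rewrite -opprD normrN.
Qed.

Lemma divr_bound (M r n : R) : 0 <= r -> `|n| <= M * r ->
  `|n / r| <= M \/ r = 0 /\ n = 0.
Proof.
rewrite le_eqVlt => /predU1P[<-|r0 nM].
  by rewrite mulr0 normr_le0 => /eqP ->; right.
by left; rewrite normrM normfV (gtr0_norm r0) ler_pdivrMr.
Qed.

(** Put a = w' / r' and b = n / r, which are bounded by M.  The difference is
    (w - w') b + a (b (r' - r) + (n - n')).  The convention x / 0 = 0 makes this
    valid when a density vanishes, because the numerators vanish with it. *)
Lemma ratio_lipschitz (M D r r' w w' n n' : R) : 1 <= M ->
  0 <= r -> 0 <= r' -> `|w| <= M * r -> `|w'| <= M * r' ->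
  `|n| <= M * r -> `|n'| <= M * r' ->
  `|r - r'| <= D -> `|w - w'| <= D -> `|n - n'| <= D ->
  `|w * (n / r) - w' * (n' / r')| <= 3 * M ^+ 2 * D.
Proof.
move=> M1 r0 r'0 wM w'M nM n'M rD wD nD.
have quot x s : 0 <= s -> `|x| <= M * s -> `|x / s| <= M /\ x / s * s = x.
  move=> s0 xM; have [xs|[-> ->]] := divr_bound s0 xM; last first.
    by rewrite !mul0r normr0; split; first lra.
  split=> //; move: s0 xM; rewrite le_eqVlt => /predU1P[<-|s0 _].
    by rewrite mulr0 normr_le0 => /eqP ->; rewrite mulr0.
  by rewrite divfK// gt_eqF.
have [nb nE] := quot n r r0 nM.
have [wb wE] := quot w' r' r'0 w'M.
have [_ n'E] := quot n' r' r'0 n'M.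
have -> : w * (n / r) - w' * (n' / r') =
    (w - w') * (n / r) + (w' / r') * ((n / r) * (r' - r) + (n - n')).
  set b := n / r in nb nE *; set a := w' / r' in wb wE *.
  set b' := n' / r' in n'E *.
  by rewrite -wE -nE -n'E; ring.
have D0 : 0 <= D by exact: le_trans rD.
have M0 : 0 <= M by lra.
have h1 : `|(w - w') * (n / r)| <= D * M by rewrite normrM ler_pM.
have h2 : `|n / r * (r' - r)| <= M * D by rewrite normrM ler_pM// distrC.
have h3 : `|w' / r' * (n / r * (r' - r) + (n - n'))| <= M * (M * D + D).
  rewrite normrM ler_pM//; apply: le_trans (ler_normD _ _) _; exact: lerD.
apply: le_trans (ler_normD _ _) _; apply: le_trans (lerD h1 h3) _.
rewrite expr2; have : M * D <= M * M * D by rewrite -mulrA ler_peMl// mulr_ge0.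
lra.
Qed.

Lemma velocity_cone (M : R) S j p :
  1 <= M -> cone M S -> `|velocity S j p| <= M.
Proof.
move=> M1 [S0 SM]; rewrite /velocity.
have [//|[-> ->]] := divr_bound (S0 p) (SM (lift ord0 j) p).
by rewrite mul0r normr0; lra.
Qed.

Lemma max0_div (a r : R) : 0 <= r -> Num.max (a / r) 0 = Num.max a 0 / r.
Proof. by move=> r0; rewrite maxr_pMl ?invr_ge0// mul0r. Qed.

Lemma normr_max0 (a : R) : `|Num.max a 0| <= `|a|.
Proof.
case: (leP a 0) => // _; by rewrite normr0.
Qed.

Lemma flux_lipschitz (M D : R) S S' k j p : 1 <= M -> cone M S -> cone M S' ->
  (forall k p, `|S k p - S' k p| <= D) ->
  `|(S k \* (velocity S j)^\+) p - (S' k \* (velocity S' j)^\+) p| <=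
    3 * M ^+ 2 * D /\
  `|(S k \* (velocity S j)^\-) p - (S' k \* (velocity S' j)^\-) p| <=
    3 * M ^+ 2 * D.
Proof.
move=> M1 [S0 SM] [S'0 S'M] SD; rewrite /= /funrpos /funrneg /velocity.
have max0N (x r : R) : 0 <= r -> Num.max (- (x / r)) 0 = Num.max (- x) 0 / r.
    by move=> r0; rewrite -mulNr max0_div.
rewrite !max0N// !max0_div//; split; apply: ratio_lipschitz => //.
- exact: le_trans (normr_max0 _) (SM _ _).
- exact: le_trans (normr_max0 _) (S'M _ _).
- by apply: ler_dist_max => //; rewrite subrr normr0; exact: le_trans (SD k p).
- by apply: le_trans (normr_max0 _) _; rewrite normrN.
- by apply: le_trans (normr_max0 _) _; rewrite normrN.
- apply: ler_dist_max; last by rewrite subrr normr0; exact: le_trans (SD k p).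
  by rewrite -opprD normrN.
Qed.

Lemma transport_rhs_lipschitz (eps M D : R) S S' k p : 0 < eps -> 1 <= M ->
  cone M S -> cone M S' -> (forall k p, `|S k p - S' k p| <= D) ->
  `|transport_rhs eps (velocity S) (S k) p -
    transport_rhs eps (velocity S') (S' k) p| <= 36 * M ^+ 2 / eps * D.
Proof.
move=> eps0 M1 cS cS' SD; rewrite !transport_rhsE -mulrBr normrM.
rewrite gtr0_norm ?invr_gt0//.
have -> : 36 * M ^+ 2 / eps * D = eps^-1 * (36 * M ^+ 2 * D) by ring.
apply: ler_wpM2l; first by rewrite invr_ge0 ltW.
(* 36 = 3 axes, times 4 fluxes, times the constant 3 of ratio_lipschitz *)
have F j q := flux_lipschitz k j q M1 cS cS' SD.
rewrite -sumrB; apply: le_trans (ler_norm_sum _ _ _) _.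
apply: (@le_trans _ _ (\sum_(j < 3) (12 * M ^+ 2 * D))); last first.
  rewrite sumr_const card_ord -mulr_natl le_eqVlt; apply/orP; left.
  by apply/eqP; ring.
apply: ler_sum => j _.
have [h1 _] := F j (p - eps *: axis R j); have [h2 h3] := F j p.
have [_ h4] := F j (p + eps *: axis R j).
by move: h1 h2 h3 h4; rewrite !ler_norml; lra.
Qed.

Lemma transport_rhs_shift (eps : R) V w a p :
  transport_rhs eps (fun j q => V j (q + a)) (fun q => w (q + a)) p =
  transport_rhs eps V w (p + a).
Proof.
rewrite /transport_rhs; congr (_ * (_ + _)); apply: eq_bigr => j _.
by rewrite /= /funrpos /funrneg !(addrAC _ _ a).
Qed.

End transport.

(** * Continuously differentiable curves in the space of the torus *)
Section C1.
Context (R : realType).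

Lemma C_torus_intro (f : space3 R -> R) :
  (forall e : R, 0 < e ->
    \forall a \near (0 : space3 R), forall p, `|f (p + a) - f p| <= e) ->
  Defs.periodic f -> C_torus f.
Proof.
move=> fu fper; split=> // p; apply/cvgrPdist_le => e /fu fe.
have xp : x - p @[x --> p] --> (0 : space3 R).
  by rewrite -(subrr p); apply: cvgB; [exact: cvg_id|exact: cvg_cst].
have : \forall x \near p, forall q, `|f (q + (x - p)) - f q| <= e := xp _ fe.
by apply: filterS => x /(_ p); rewrite (addrC p) subrK distrC.
Qed.

(** By the mean value theorem, a difference quotient at p is a value of dF at p
    and a nearby time, so both limits follow from the continuity of dF in time,
    uniform in p. *)
Lemma C1_halfline_intro (F dF : R -> space3 R -> R) :
  (forall t, 0 <= t -> C_torus (F t)) ->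
  (forall t, 0 <= t -> C_torus (dF t)) ->
  (forall (t : R) p, 0 <= t -> is_derive t 1 (F ^~ p) (dF t p)) ->
  (forall t e : R, 0 <= t -> 0 < e ->
    \forall s \near t, 0 <= s -> forall p, `|dF s p - dF t p| <= e) ->
  C1_halfline F dF.
Proof.
move=> FC dFC FdF dFu t t0; split; [exact: FC|exact: dFC| |]; last first.
  by apply: sup_norm_cvg0 => e e0; apply: dFu.
apply: sup_norm_cvg0 => e e0.
have /nbhs_ballP[d /= d0 dP] := dFu t e t0 e0.
have P (c : R) p : 0 <= c -> `|c - t| < d -> `|dF c p - dF t p| <= e.
  by move=> c0 cd; apply: dP => //; rewrite /ball /= distrC.
suff H : \forall h \near (0 : R), h != 0 -> 0 <= t + h ->
    forall p, `|h^-1 * (F (t + h) p - F t p) - dF t p| <= e.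
  by rewrite /dnbhs !near_withinE.
have : \forall h \near (0 : R), `|h| < d.
  apply/nbhs_ballP; exists d => // h; rewrite /ball /= sub0r normrN//.
apply: filterS => h hd h0 th p.
have [hp|hn] : 0 < h \/ h < 0.
  by move: h0; rewrite neq_lt => /orP[]; [right|left].
- have tth : t <= t + h by lra.
  have [c /andP[tc cth] ->] := MVT_halfline t0 tth (fun s s0 => FdF s p s0).
  rewrite addrAC subrr add0r mulrCA mulVf// mulr1; apply: P; first by lra.
  by rewrite ger0_norm; move: hd; rewrite ?(gtr0_norm hp); lra.
- have tht : t + h <= t by lra.
  have [c /andP[tc cth] E] := MVT_halfline th tht (fun s s0 => FdF s p s0).
  rewrite -(opprB (F t p)) E opprD addrA subrr add0r !mulrN opprK.
  rewrite mulrCA mulVf// mulr1.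
  apply: P; first by lra.
  by rewrite ler0_norm; move: hd; rewrite ?(ltr0_norm hn); lra.
Qed.

End C1.

(** * Global solutions of the system *)
Section ode_solution.
Context (R : realType) (eps M : R) (eps_gt0 : 0 < eps) (M_ge1 : 1 <= M).

Let lam : R := 3 * M / eps.

Let M_gt0 : 0 < M. Proof. exact: lt_le_trans M_ge1. Qed.

Let lam_gt0 : 0 < lam. Proof. by rewrite divr_gt0// mulr_gt0. Qed.

(** What remains of the clipped right-hand side once the loss - lam * S is set
    apart: unlike the whole right-hand side, it belongs to the cone. *)
Definition gain (S : 'I_4 -> space3 R -> R) : 'I_4 -> space3 R -> R :=
  fun k p => lam * clip M S k p +
    transport_rhs eps (velocity (clip M S)) (clip M S k) p.

Definition clipped_field (f : 'I_4 * space3 R -> R) : 'I_4 * space3 R -> R :=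
  fun kp => - lam * f kp + gain (fun k p => f (k, p)) kp.1 kp.2.

Definition field_lip : R := lam + (lam * M + 36 * M ^+ 2 / eps * M).

Lemma field_lip_gt0 : 0 < field_lip.
Proof.
by rewrite /field_lip addr_gt0// addr_gt0// !mulr_gt0// ?invr_gt0.
Qed.

Lemma clipped_field_lipschitz (f g : 'I_4 * space3 R -> R) (D : R) :
  (forall kp, `|f kp - g kp| <= D) ->
  forall kp, `|clipped_field f kp - clipped_field g kp| <= field_lip * D.
Proof.
move=> fgD [k p]; rewrite /clipped_field /gain /=.
set S := (fun k p => f (k, p)); set S' := (fun k p => g (k, p)).
have SD k' p' : `|S k' p' - S' k' p'| <= D by exact: fgD.
have cD := clip_lipschitz M_ge1 SD.
have h1 : `|lam * (f (k, p) - g (k, p))| <= lam * D.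
  by rewrite normrM (gtr0_norm lam_gt0) ler_wpM2l// ltW.
have h2 : `|lam * (clip M S k p - clip M S' k p)| <= lam * (M * D).
  by rewrite normrM (gtr0_norm lam_gt0) ler_wpM2l// ltW.
have h3 := transport_rhs_lipschitz k p eps_gt0 M_ge1 (clip_cone S M_ge1)
  (clip_cone S' M_ge1) cD.
rewrite /field_lip !mulrDl -!(mulrA _ M D).
by move: h1 h2 h3; rewrite !mulrBr !ler_norml; lra.
Qed.

(** The operator of transport_rhs_ge is linear in the transported quantity for
    given velocities, so it preserves the nonnegativity of M rho + m and of
    M rho - m. *)
Lemma gain_cone S : (forall p, 0 <= gain S ord0 p) /\
  forall k p, `|gain S k p| <= M * gain S ord0 p.
Proof.
set c := clip M S.
have cS : cone M c := clip_cone S M_ge1.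
have VM j q : `|velocity c j q| <= M by exact: velocity_cone.
have lin a k p : 0 <= a -> (forall q, 0 <= a * c ord0 q + c k q) ->
    0 <= a * gain S ord0 p + gain S k p.
  move=> a0 w0; have := transport_rhs_ge p eps_gt0 VM w0.
  by rewrite transport_rhsD /gain -/c -/lam; lra.
split => [p|k p].
  have := lin 0 ord0 p (lexx _); rewrite mul0r add0r; apply => q.
  by rewrite mul0r add0r; exact: cS.1.
have lo := lin M k p; have M0 : 0 <= M := ltW M_gt0.
rewrite ler_norml; apply/andP; split.
  have : 0 <= M * gain S ord0 p + gain S k p; last by lra.
  apply: lin => // q; have := cS.2 k q; rewrite ler_norml; lra.
have w0 q : 0 <= (- 1) * c k q + M * c ord0 q.
  by have := cS.2 k q; rewrite ler_norml; lra.
have := transport_rhs_ge p eps_gt0 VM w0.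
rewrite transport_rhsD.
have -> : transport_rhs eps (velocity c) (fun q => M * c ord0 q) p =
    M * transport_rhs eps (velocity c) (c ord0) p.
  have := transport_rhsD eps (M - 1) (velocity c) (c ord0) (c ord0) p.
  have -> : (fun q => (M - 1) * c ord0 q + c ord0 q) = (fun q => M * c ord0 q).
    by apply/funext => q; ring.
  by move=> ->; ring.
by rewrite /gain -/c -/lam; lra.
Qed.

(** The function exp (lam s) * f s is nondecreasing. *)
Lemma exp_decay_ge (f df : R -> R) (t : R) : 0 <= t ->
  (forall s : R, 0 <= s -> is_derive s 1 f (df s)) ->
  (forall s, 0 <= s -> 0 <= df s + lam * f s) ->
  expR (- lam * t) * f 0 <= f t.
Proof.
move=> t0 fd fge.
have d (s : R) : 0 <= s -> is_derive s 1 (fun s => expR (lam * s) * f s)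
    (expR (lam * s) * (df s + lam * f s)).
  move=> s0; have fds := fd s s0.
  have -> : (fun s => expR (lam * s) * f s) =
    (expR \o (fun s => lam * s)) * f by [].
  apply: is_derive_eq.
  rewrite /= /GRing.scale /= !mulr1; ring.
have : expR (lam * 0) * f 0 <= expR (lam * t) * f t.
  have := @le_increment _ (cst 0) (cst 0) _ _ 0 t (lexx _) t0
    (fun s _ => is_derive_cst 0 s 1) d.
  rewrite /= subrr subr_ge0; apply => s s0.
  by rewrite mulr_ge0 ?fge// expR_ge0.
rewrite mulr0 expR0 mul1r => H.
rewrite mulNr expRN ler_pdivrMl ?expR_gt0//.
Qed.

(** The solution of the clipped system satisfies S' + lam * S = gain S, which
    belongs to the cone.  By exp_decay_ge the solution stays in the cone with a
    positive density, and there clipping does nothing. *)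
Theorem ode_solution_exists (S0 : 'I_4 -> space3 R -> R) :
  (forall k, C_torus (S0 k)) -> (forall p, 0 < S0 ord0 p) ->
  (forall k p, `|S0 k p| <= M * S0 ord0 p) ->
  exists U dU, ode_solution eps S0 U dU /\
    forall t k p, 0 <= t -> `|U t k p| <= M * U t ord0 p.
Proof.
move=> S0C S0_gt0 S0M.
pose y0 (kp : 'I_4 * space3 R) := S0 kp.1 kp.2.
have /choice[B BP] : forall k, exists B, forall p, `|S0 k p| <= B.
  by move=> k; exact: C_torus_bounded.
pose C := \sum_(k < 4) `|B k|.
have y0C kp : `|y0 kp| <= C.
  apply: le_trans (BP kp.1 kp.2) _; apply: le_trans (ler_norm _) _.
  by rewrite /C (bigD1 kp.1)//= lerDl sumr_ge0.
have field0 kp : clipped_field (fun=> 0) kp = 0.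
  have cone0 : cone M (fun (_ : 'I_4) (_ : space3 R) => 0).
    by split => *; rewrite ?mulr0 ?normr0.
  rewrite /clipped_field /gain mulr0 add0r (clip_id _ _ cone0) mulr0 add0r.
  rewrite transport_rhsE big1 ?mulr0// => j _.
  by rewrite /= !(clip_id _ _ cone0) !mul0r !subrr addr0.
have Ay0 kp : `|clipped_field y0 kp| <= field_lip * C.
  have := @clipped_field_lipschitz y0 (fun=> 0) C _ kp.
  by rewrite field0 subr0; apply => q; rewrite subr0.
have [y [yC y00 dy]] :=
  lipschitz_ode_existence field_lip_gt0 clipped_field_lipschitz Ay0.
pose U t k p := y t (k, p); pose dU t k p := clipped_field (y t) (k, p).
have dUE (t : R) k p : 0 <= t -> is_derive t 1 (fun s => U s k p) (dU t k p).
  exact: dy.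
have U0 k p : U 0 k p = S0 k p by rewrite /U y00.
have gainE t k p : dU t k p + lam * U t k p = gain (U t) k p.
  by rewrite /dU /clipped_field /= -/(U t) /U; ring.
have Upos t p : 0 <= t -> 0 < U t ord0 p.
  move=> t0.
  apply: lt_le_trans (exp_decay_ge t0 (fun s s0 => dUE s ord0 p s0) _).
    by rewrite mulr_gt0 ?expR_gt0// U0.
  by move=> s s0; rewrite gainE; exact: (gain_cone _).1.
have UM t k p : 0 <= t -> `|U t k p| <= M * U t ord0 p.
  move=> t0; rewrite ler_norml; apply/andP; split.
    rewrite -subr_ge0 opprK.
    have := @exp_decay_ge (fun t => U t k p + M * U t ord0 p)
      (fun t => dU t k p + M * dU t ord0 p) t t0.
    have := S0M k p; rewrite -!U0 ler_norml => /andP[h _].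
    move=> H; apply: le_trans (H _ _).
    - by rewrite mulr_ge0 ?expR_ge0//; lra.
    - move=> s s0.
      apply: is_deriveD; first exact: dUE.
      by have := is_deriveZ M (dUE s ord0 p s0).
    - move=> s s0; have := (gain_cone (U s)).2 k p.
      by rewrite -!gainE ler_norml; lra.
  rewrite -subr_ge0.
  have := @exp_decay_ge (fun t => M * U t ord0 p - U t k p)
    (fun t => M * dU t ord0 p - dU t k p) t t0.
  have := S0M k p; rewrite -!U0 ler_norml => /andP[_ h].
  move=> H; apply: le_trans (H _ _).
  - by rewrite mulr_ge0 ?expR_ge0//; lra.
  - move=> s s0.
    apply: is_deriveB; last exact: dUE.
    by have := is_deriveZ M (dUE s ord0 p s0).
  - move=> s s0; have := (gain_cone (U s)).2 k p.
    by rewrite -!gainE ler_norml; lra.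
have Ucone t : 0 <= t -> cone M (U t).
  by move=> t0; split => *; [exact/ltW/Upos|exact: UM].
(* The field commutes with translations, so ya a solves the system with
   translated initial data, and stability compares it with y. *)
pose ya (a : space3 R) t (kp : 'I_4 * space3 R) := y t (kp.1, kp.2 + a).
have field_shift (f : 'I_4 * space3 R -> R) a k p :
    clipped_field (fun kp => f (kp.1, kp.2 + a)) (k, p) =
    clipped_field f (k, p + a).
  by rewrite /clipped_field /gain /= -transport_rhs_shift.
have stab a (D : R) : (forall k p, `|S0 k (p + a) - S0 k p| <= D) ->
    forall t k p, 0 <= t ->
      `|U t k (p + a) - U t k p| <= 2 * D * expR (2 * field_lip * t).
  move=> SD t k p t0.
  have yaC : exp_growth field_lip C (ya a).
    by move=> s r [k' p'] s0 sr; exact: yC.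
  have dya (s : R) kp : 0 <= s ->
      is_derive s 1 (ya a ^~ kp) (clipped_field (ya a s) kp).
    by move=> s0; case: kp => k' p'; rewrite field_shift; exact: dy.
  apply: (lipschitz_ode_stability field_lip_gt0 clipped_field_lipschitz
    yaC yC dya dy _ (k, p) t0) => -[k' p'].
  by rewrite /ya /= y00; exact: SD.
have Uper t k : 0 <= t -> Defs.periodic (U t k).
  move=> t0 j p; apply/eqP; rewrite -subr_eq0 -normr_le0.
  have := @stab ((2 * pi) *: axis R j) 0 _ t k p t0; rewrite mulr0 mul0r; apply.
  by move=> k' p'; rewrite (S0C k').2 subrr normr0.
have Uunif t (e : R) : 0 <= t -> 0 < e ->
    \forall a \near (0 : space3 R), forall k p, `|U t k (p + a) - U t k p| <= e.
  move=> t0 e0.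
  pose E := expR (2 * field_lip * t); have E0 : 0 < E := expR_gt0 _.
  have D0 : 0 < e / (2 * E) by rewrite divr_gt0// mulr_gt0.
  have H : \forall a \near (0 : space3 R), forall k p,
      `|S0 k (p + a) - S0 k p| <= e / (2 * E).
    exact: (@filter_forall _ _ (fun k a => forall p,
      `|S0 k (p + a) - S0 k p| <= e / (2 * E)) (nbhs (0 : space3 R)) _
      (fun k => C_torus_unif_continuous (S0C k) D0)).
  apply: filterS H => a SD k p; apply: le_trans (stab a _ SD t k p t0) _.
  by rewrite -/E le_eqVlt; apply/orP; left; apply/eqP; field; exact: lt0r_neq0.
have dU_lip t s (D : R) : (forall k p, `|U t k p - U s k p| <= D) ->
    forall k p, `|dU t k p - dU s k p| <= field_lip * D.
  by move=> H k p; apply: clipped_field_lipschitz => -[k' p']; exact: H.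
have dUunif t (e : R) : 0 <= t -> 0 < e ->
    \forall a \near (0 : space3 R),
      forall k p, `|dU t k (p + a) - dU t k p| <= e.
  move=> t0 e0; have L0 := field_lip_gt0.
  apply: filterS (Uunif t _ t0 (divr_gt0 e0 L0)) => a SD k p.
  rewrite (_ : e = field_lip * (e / field_lip)); last first.
    by rewrite mulrCA divff ?mulr1// gt_eqF.
  rewrite /dU -field_shift; apply: clipped_field_lipschitz => -[k' p'].
  exact: SD.
have dUper t k : 0 <= t -> Defs.periodic (dU t k).
  move=> t0 j p; rewrite /dU -field_shift; congr (clipped_field _ _).
  by apply/funext => -[k' p']; exact: Uper.
have UC t k : 0 <= t -> C_torus (U t k).
  move=> t0; apply: C_torus_intro; last exact: Uper.
  by move=> e e0; apply: filterS (Uunif t e t0 e0).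
have dUC t k : 0 <= t -> C_torus (dU t k).
  move=> t0; apply: C_torus_intro; last exact: dUper.
  by move=> e e0; apply: filterS (dUunif t e t0 e0).
exists U, dU; split => //; split => //.
- move=> k; apply: C1_halfline_intro.
  + by move=> t; exact: UC.
  + by move=> t; exact: dUC.
  + move=> t e t0 e0; have L0 := field_lip_gt0.
    have := exp_growth_continuous yC t0 (divr_gt0 e0 L0).
    apply: filterS => s ys s0 p.
    rewrite (_ : e = field_lip * (e / field_lip)); last first.
      by rewrite mulrCA divff ?mulr1// gt_eqF.
    by apply: dU_lip => k' p'; exact: ys.
- move=> t k p t0; have cU := Ucone t t0.
  have -> : dU t k p = gain (U t) k p - lam * U t k p by rewrite -gainE; ring.
  have clipE : clip M (U t) = U t.
    by apply/funext => k'; apply/funext => p'; exact: clip_id.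
  by rewrite /gain clipE addrAC subrr add0r.
Qed.

End ode_solution.

Notation mspace R :=
  (measurableTypeR R * measurableTypeR R * measurableTypeR R)%type.

(** * Lebesgue measure on R^3 *)
Section measurability.
Context (R : realType).

(** The sigma-algebra is a product, so an open set has to be written as a
    countable union of boxes, here with rational centres and sides
    2 / (n + 1). *)
Lemma open_measurable3 (A : set (space3 R)) :
  open A -> measurable (A : set (mspace R)).
Proof.
move=> oA.
pose box (q : rat * rat * rat) (n : nat) : set (mspace R) :=
  `]ratr q.1.1 - n.+1%:R^-1, ratr q.1.1 + n.+1%:R^-1[%classic `*`
  `]ratr q.1.2 - n.+1%:R^-1, ratr q.1.2 + n.+1%:R^-1[%classic `*`
  `]ratr q.2 - n.+1%:R^-1, ratr q.2 + n.+1%:R^-1[%classic.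
pose F q1 q2 q3 n := if `[< box (q1, q2, q3) n `<=` A >] then box (q1, q2, q3) n
  else set0.
have -> : A = \bigcup_q1 \bigcup_q2 \bigcup_q3 \bigcup_n F q1 q2 q3 n.
  apply/seteqP; split=> [[[x y] z] Ap|[[x y] z] [q1 _ [q2 _ [q3 _ [n _]]]]].
    have /nbhs_ballP[e /= e0 eA] : nbhs (x, y, z) A by exact: open_nbhs_nbhs.
    have [n ne] : exists n : nat, n.+1%:R^-1 < e / 2.
      have e2 : 0 < (e / 2)^-1 by rewrite invr_gt0 divr_gt0.
      exists (Num.truncn (e / 2)^-1); rewrite invf_plt ?posrE ?divr_gt0 ?ltr0n//.
      by rewrite truncnS_gt.
    pose w : R := n.+1%:R^-1.
    have w0 : 0 < w by rewrite invr_gt0 ltr0n.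
    have near_rat (u : R) : exists q : rat, u - w < ratr q < u + w.
      have uu : u - w < u + w by lra.
      by have [q] := rat_in_itvoo uu; rewrite in_itv /=; exists q.
    have [q1 h1] := near_rat x; have [q2 h2] := near_rat y.
    have [q3 h3] := near_rat z.
    exists q1 => //; exists q2 => //; exists q3 => //; exists n => //.
    rewrite /F /box -/w in ne *; rewrite asboolT; first by
      rewrite /box; split; [split|] => /=; rewrite in_itv /=; lra.
    move=> [[x' y'] z'] [[/=]]; rewrite !in_itv /= => k1 k2 k3.
    by apply: eA; split; [split|] => /=; rewrite /ball /= ltr_norml; lra.
  by rewrite /F; case: asboolP => // sub; exact: sub.
apply: bigcupT_measurable_rat => q1; apply: bigcupT_measurable_rat => q2.
apply: bigcupT_measurable_rat => q3; apply: bigcupT_measurable => n.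
rewrite /F; case: ifP => // _.
by apply: measurableX; [apply: measurableX|]; exact: measurable_itv.
Qed.

Lemma continuous_measurable3 (f : space3 R -> R) : continuous f ->
  measurable_fun [set: mspace R] (f : mspace R -> R).
Proof.
move=> /continuousP cf; apply: (measurability _ (@RGenOpens.measurableE R)).
move=> _ [_ [a [b ->] <-]]; rewrite setTI.
by apply: open_measurable3; apply: cf; exact: interval_open.
Qed.

End measurability.

Section translation.
Context (R : realType).
Local Open Scope ereal_scope.

(** A section of the preimage is the preimage of a section. *)
Lemma measure_preserving_prod d1 d2 (T1 : measurableType d1)
    (T2 : measurableType d2)
    (m1 : {measure set T1 -> \bar R})
    (m2 : {sigma_finite_measure set T2 -> \bar R})
    (f1 : T1 -> T1) (f2 : T2 -> T2) :
  measurable_fun setT f1 ->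
  (forall A, measurable A -> m1 (f1 @^-1` A) = m1 A) ->
  (forall A, measurable A -> m2 (f2 @^-1` A) = m2 A) ->
  forall A, measurable A ->
    (m1 \x m2) ((fun z => (f1 z.1, f2 z.2)) @^-1` A) = (m1 \x m2) A.
Proof.
move=> mf1 H1 H2 A mA; rewrite /product_measure1.
transitivity (\int[m1]_(x in setT) ((m2 \o xsection A) \o f1) x).
  apply: eq_integral => x _ /=.
  rewrite -(H2 (xsection A (f1 x))); last exact: measurable_xsection.
  by congr (m2 _); apply/seteqP; split => y /=; rewrite /xsection /= !inE.
have := @ge0_integral_pushforward _ _ _ _ R _ mf1 m1 setT (m2 \o xsection A)
  measurableT (measurable_fun_xsection m2 mA) (fun y _ => measure_ge0 m2 _).
rewrite preimage_setT => <-.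
by apply: eq_measure_integral => B mB _; exact: H1.
Qed.

Lemma lebesgue_measure_shift (a : R) (A : set (measurableTypeR R)) :
  measurable A ->
  lebesgue_measure ((fun x => (x + a)%R) @^-1` A) = lebesgue_measure A.
Proof.
move=> mA.
have mf : measurable_fun [set: measurableTypeR R]
    ((fun x => (x + a)%R) : measurableTypeR R -> measurableTypeR R).
  exact: measurable_funD.
pose mfM := isMeasurableFun.Build _ _ _ _ _ mf.
pose f : {mfun measurableTypeR R >-> measurableTypeR R} :=
  HB.pack (fun x : measurableTypeR R => (x + a)%R : measurableTypeR R) mfM.
apply/esym; apply: (@lebesgue_measure_unique _
  (pushforward lebesgue_measure f) _ A mA) => _ [[u v]] _ <-.
transitivity (lebesgue_measure (`](u - a)%R, (v - a)%R]%classic :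
    set (measurableTypeR R))); last first.
  congr lebesgue_measure.
  by apply/seteqP; split => x /=; rewrite !in_itv /= lerBrDr ltrBlDr.
rewrite !lebesgue_measure_itv /= !lte_fin ltrD2r; case: ifP => // _.
by rewrite -!EFinD; congr (_%:E); rewrite opprB addrA subrK.
Qed.

Lemma lebesgue3_shift (a : space3 R) (A : set (mspace R)) : measurable A ->
  lebesgue3 R ((fun p => (p + a)%R) @^-1` A) = lebesgue3 R A.
Proof.
move=> mA.
have mf (b : R) : measurable_fun [set: measurableTypeR R]
    ((fun x => (x + b)%R) : measurableTypeR R -> measurableTypeR R).
  exact: measurable_funD.
have mg : measurable_fun setT (fun z : measurableTypeR R * measurableTypeR R =>
    ((z.1 + a.1.1)%R, (z.2 + a.1.2)%R) : measurableTypeR R * measurableTypeR R).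
  apply: measurable_fun_pair.
    exact: (measurableT_comp (mf a.1.1) measurable_fst).
  exact: (measurableT_comp (mf a.1.2) measurable_snd).
have H b := @lebesgue_measure_shift b.
pose mu : {sigma_finite_measure set (measurableTypeR R) -> \bar R} :=
  lebesgue_measure.
have H2 := @measure_preserving_prod _ _ _ _ mu mu _ _ (mf _)
  (H a.1.1) (H a.1.2).
have E := @measure_preserving_prod _ _ _ _ (mu \x mu) mu _ _ mg H2 (H a.2) A mA.
exact: E.
Qed.

Lemma measurable_shift3 (a : space3 R) :
  measurable_fun [set: mspace R]
    ((fun p : mspace R => (p + a)%R) : mspace R -> mspace R).
Proof.
apply: measurable_fun_pair => /=.
  apply: measurable_fun_pair => /=; apply: measurable_funD => //.
    by apply: measurableT_comp; [exact: measurable_fst|exact: measurable_fst].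
  by apply: measurableT_comp; [exact: measurable_snd|exact: measurable_fst].
by apply: measurable_funD => //; exact: measurable_snd.
Qed.

Lemma ge0_integral_shift3 (f : mspace R -> \bar R) (a : space3 R) :
  measurable_fun setT f -> (forall p, 0 <= f p) ->
  \int[lebesgue3 R]_p f (p + a)%R = \int[lebesgue3 R]_p f p.
Proof.
move=> mf f0.
have := @ge0_integral_pushforward _ _ _ _ R _ (measurable_shift3 a)
  (lebesgue3 R) setT f measurableT mf (fun y _ => f0 y).
rewrite preimage_setT => /= <-.
apply: eq_measure_integral => [|? A mA _]; first exact: measurable_shift3.
exact: (lebesgue3_shift a mA).
Qed.

Lemma integrable_shift3 (f : mspace R -> \bar R) (a : space3 R) :
  (lebesgue3 R).-integrable setT f ->
  (lebesgue3 R).-integrable setT (fun p => f (p + a)%R).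
Proof.
move=> /integrableP[mf fi]; apply/integrableP; split.
  exact: (measurableT_comp mf (measurable_shift3 a)).
have mabs : measurable_fun setT (abse \o f) by exact: measurableT_comp.
by rewrite (ge0_integral_shift3 a mabs (fun p => abse_ge0 (f p))).
Qed.

Lemma integral_shift3 (f : mspace R -> \bar R) (a : space3 R) :
  (lebesgue3 R).-integrable setT f ->
  \int[lebesgue3 R]_p f (p + a)%R = \int[lebesgue3 R]_p f p.
Proof.
move=> fi; have /integrableP[mf _] := fi.
have := @integral_pushforward _ _ _ _ R _ (measurable_shift3 a) (lebesgue3 R)
  setT f mf (integrable_shift3 a fi) measurableT.
rewrite preimage_setT => /= <-.
apply: eq_measure_integral => [|? A mA _]; first exact: measurable_shift3.
exact: (lebesgue3_shift a mA).
Qed.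

End translation.

(** * Integrals over boxes and over a period cell *)
Section box_integrals.
Context (R : realType).
Implicit Types (f g : space3 R -> R) (p a b : space3 R).

(** Half-open, so that boxes that share a face do not overlap. *)
Definition rect a b : set (mspace R) :=
  `[a.1.1, b.1.1[%classic `*` `[a.1.2, b.1.2[%classic `*` `[a.2, b.2[%classic.

Lemma measurable_rect a b : measurable (rect a b).
Proof. by apply: measurableX; [apply: measurableX|]; exact: measurable_itv. Qed.

Lemma rect_indicE a b p : \1_(rect a b) p =
  [&& a.1.1 <= p.1.1 < b.1.1, a.1.2 <= p.1.2 < b.1.2 & a.2 <= p.2 < b.2]%:R :> R.
Proof.
rewrite indicE; congr (nat_of_bool _)%:R; apply/idP/idP.
  by rewrite inE => -[[/=]]; rewrite !in_itv /= => -> -> ->.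
by move=> /and3P[h1 h2 h3]; rewrite inE; split; [split|] => /=; rewrite in_itv.
Qed.

Lemma lebesgue3_rect a b :
  a.1.1 < b.1.1 -> a.1.2 < b.1.2 -> a.2 < b.2 ->
  lebesgue3 R (rect a b) =
    ((b.1.1 - a.1.1) * (b.1.2 - a.1.2) * (b.2 - a.2))%:E.
Proof.
move=> h1 h2 h3; rewrite /lebesgue3 /=.
rewrite product_measure1E; last exact: measurable_itv; last first.
  by apply: measurableX; exact: measurable_itv.
rewrite /= product_measure1E; [|exact: measurable_itv|exact: measurable_itv].
by rewrite /= !lebesgue_measure_itv /= !lte_fin h1 h2 h3 -!EFinD -!EFinM.
Qed.

Lemma lebesgue3_rect_fin a b : (lebesgue3 R (rect a b) < +oo)%E.
Proof.
(* The box may be degenerate: it is enlarged to one with positive sides. *)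
pose mx (u v : R) := Num.max u v + 1.
pose b' := (mx a.1.1 b.1.1, mx a.1.2 b.1.2, mx a.2 b.2).
have mxP (u v : R) : u < mx u v /\ v <= mx u v.
  by rewrite /mx; case: (leP u v) => ?; split; lra.
have sub : rect a b `<=` rect a b'.
  move=> p [[/=]]; rewrite !in_itv /= => /andP[h1 k1] /andP[h2 k2] /andP[h3 k3].
  by split; [split|] => /=; rewrite in_itv /=; apply/andP; split => //;
    apply: lt_le_trans (mxP _ _).2.
apply: (@le_lt_trans _ _ (lebesgue3 R (rect a b'))).
  by apply: le_measure => //; rewrite inE; exact: measurable_rect.
rewrite lebesgue3_rect ?ltry//; exact: (mxP _ _).1.
Qed.

Lemma rect_continuous_bounded f a b : continuous f ->
  exists M, forall p, rect a b p -> `|f p| <= M.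
Proof.
move=> cf.
have cK : compact (`[a.1.1, b.1.1]%classic `*` `[a.1.2, b.1.2]%classic `*`
    `[a.2, b.2]%classic : set (space3 R)).
  by do 2 ?apply: compact_setX; exact: segment_compact.
have [M MP] := compact_continuous_bounded cK cf.
exists M => p [[/=]]; rewrite !in_itv /= => /andP[? ?] /andP[? ?] /andP[? ?].
apply: MP; split; [split|] => /=; rewrite in_itv /=; apply/andP; split => //;
  exact: ltW.
Qed.

Lemma integrable_rect f a b : continuous f ->
  (lebesgue3 R).-integrable setT (EFin \o (fun p => \1_(rect a b) p * f p)).
Proof.
move=> cf.
have [M MP] := rect_continuous_bounded a b cf.
have -> : EFin \o (fun p => \1_(rect a b) p * f p) =
    ((EFin \o f) \_ (rect a b)).
  apply/funext => p; rewrite /patch /= indicE.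
  by case: ifP; rewrite ?mul1r ?mul0r.
apply/(integrable_mkcond _ (measurable_rect a b)).
apply: measurable_bounded_integrable.
- exact: measurable_rect.
- exact: lebesgue3_rect_fin.
- by apply: measurable_funTS; exact: continuous_measurable3.
- exists M; split; first exact: num_real.
  by move=> x Mx p ap /=; apply: le_trans (ltW Mx); exact: MP.
Qed.

Lemma Rintegral_shift3 (f : mspace R -> R) a :
  (lebesgue3 R).-integrable setT (EFin \o f) ->
  \int[lebesgue3 R]_p f (p + a) = \int[lebesgue3 R]_p f p.
Proof.
by move=> fi; rewrite /Rintegral; congr fine; exact: (integral_shift3 a fi).
Qed.

End box_integrals.

Section mass.
Context (R : realType).
Implicit Types (f g : space3 R -> R) (p a : space3 R).

Definition period : space3 R := (2 * pi, 2 * pi, 2 * pi).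

(** The integral over the torus, written over R^3 so that the translation
    invariance of lebesgue3 applies. *)
Definition mass f : R :=
  \int[lebesgue3 R]_p (\1_(rect (0 : space3 R) period) p * f p).

Lemma rect_cell : rect (0 : space3 R) period = @cell R.
Proof. by []. Qed.

Lemma massD f g : continuous f -> continuous g ->
  mass (fun p => f p + g p) = mass f + mass g.
Proof.
have cR := @integrable_rect R _ 0 period.
move=> /cR cf /cR cg; rewrite /mass -RintegralD//.
by apply: eq_Rintegral => p _; rewrite mulrDr.
Qed.

Lemma massB f g : continuous f -> continuous g ->
  mass (fun p => f p - g p) = mass f - mass g.
Proof.
have cR := @integrable_rect R _ 0 period.
move=> /cR cf /cR cg; rewrite /mass -RintegralB//.
by apply: eq_Rintegral => p _; rewrite mulrBr.
Qed.

Lemma massZ (c : R) f : continuous f -> mass (fun p => c * f p) = c * mass f.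
Proof.
move=> cf; rewrite /mass -RintegralZl//; last exact: integrable_rect.
by apply: eq_Rintegral => p _; rewrite mulrCA.
Qed.

Lemma le_mass f g : continuous f -> continuous g -> (forall p, f p <= g p) ->
  mass f <= mass g.
Proof.
move=> cf cg fg; apply: le_Rintegral => //; try exact: integrable_rect.
by move=> p _; rewrite ler_wpM2l// indicE.
Qed.

Lemma mass_ge0 f : (forall p, 0 <= f p) -> 0 <= mass f.
Proof. by move=> f0; apply: Rintegral_ge0 => p _; rewrite mulr_ge0// indicE. Qed.

Lemma normr_mass_le f (M : R) : continuous f -> (forall p, `|f p| <= M) ->
  `|mass f| <= M * mass (fun=> 1).
Proof.
move=> cf fM.
have cc (c : R) : continuous (fun _ : space3 R => c) by move=> p; exact: cvg_cst.
have E (c : R) : c * mass (fun=> 1) = mass (fun=> c).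
  by rewrite -massZ//; congr mass; apply/funext => p; rewrite mulr1.
rewrite ler_norml -mulNr !E; apply/andP; split; apply: le_mass => // p;
  by have := fM p; rewrite ler_norml => /andP[].
Qed.

Lemma itv_swap (x e : R) : 0 <= e <= 2 * pi ->
  (0 <= x - e < 2 * pi)%R%:R + (0 <= x < e)%R%:R =
  (0 <= x < 2 * pi)%R%:R + (0 <= x - 2 * pi < e)%R%:R :> R.
Proof.
move=> /andP[e0 e2].
case: (leP 0 (x - e)) => h1; case: (ltP (x - e) (2 * pi)) => h2;
case: (leP 0 x) => h3; case: (ltP x e) => h4; case: (ltP x (2 * pi)) => h5;
case: (leP 0 (x - 2 * pi)) => h6; case: (ltP (x - 2 * pi) e) => h7 //=;
 rewrite ?addr0 ?add0r //; exfalso; lra.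
Qed.

(** The upper corner of the part of the cell at distance less than e from its
    lower face orthogonal to the axis j. *)
Definition slab_corner (j : 'I_3) (e : R) : space3 R :=
  (if j == 0 :> nat then e else 2 * pi,
   if j == 1 :> nat then e else 2 * pi, if j == 2 :> nat then e else 2 * pi).

(** Moving the cell by e along an axis trades the slab next to its lower face
    for the translate of this slab by one period. *)
Lemma rect_swap (j : 'I_3) (e : R) p : 0 <= e <= 2 * pi ->
  \1_(rect (0 : space3 R) period) (p - e *: axis R j) +
    \1_(rect (0 : space3 R) (slab_corner j e)) p =
  \1_(rect (0 : space3 R) period) p +
    \1_(rect (0 : space3 R) (slab_corner j e)) (p - (2 * pi) *: axis R j) :> R.
Proof.
move=> e02; rewrite !rect_indicE /period /slab_corner /axis.
case: p => [[x y] z].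
have z1 (u c : R) : u - c *: (1 : R^o) = u - c by congr (_ - _); exact: mulr1.
have z0 (u c : R) : u - c *: (0 : R^o) = u by rewrite scaler0 subr0.
case: j => -[|[|[|//]]] jlt /=; rewrite !z1 !z0.
- case: (0 <= y < _) => /=; rewrite ?andbF ?addr0//=.
  case: (0 <= z < _) => /=; rewrite ?andbF ?addr0//= ?andbT; exact: itv_swap.
- case: (0 <= x < _) => /=; rewrite ?andbF ?addr0//=.
  case: (0 <= z < _) => /=; rewrite ?andbF ?addr0//= ?andbT; exact: itv_swap.
- case: (0 <= x < _) => /=; rewrite ?andbF ?addr0//=.
  case: (0 <= y < _) => /=; rewrite ?andbF ?addr0//= ?andbT; exact: itv_swap.
Qed.

(** The two slabs of rect_swap carry the same integral, by periodicity. *)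
Lemma mass_shift_ge0 f (j : 'I_3) (e : R) : C_torus f -> 0 <= e <= 2 * pi ->
  mass (fun p => f (p + e *: axis R j)) = mass f.
Proof.
move=> [cf fper] e02; set a := e *: axis R j.
have cfa := continuous_shift (a := a) cf.
pose L := period; pose Le := slab_corner j e.
pose slab := rect (0 : space3 R) Le.
have swap := rect_swap j _ e02.
have shifted (b : space3 R) u v (g : space3 R -> R) : continuous g ->
    (lebesgue3 R).-integrable setT
      (EFin \o (fun p => \1_(rect u v) (p - b) * g p)).
  move=> cg.
  have := integrable_shift3 (- b) (integrable_rect u v (continuous_shift (a := b) cg)).
  by congr (_.-integrable _ _); apply/funext => p /=; rewrite subrK.
have E1 : mass (fun p => f (p + a)) =
    \int[lebesgue3 R]_p (\1_(rect (0 : space3 R) L) (p - a) * f p).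
  rewrite -(Rintegral_shift3 a (shifted a 0 L f cf)).
  by apply: eq_Rintegral => p _; rewrite addrK.
have E2 : \int[lebesgue3 R]_p (\1_slab p * f p) =
    \int[lebesgue3 R]_p (\1_slab (p - (2 * pi) *: axis R j) * f p).
  rewrite -(Rintegral_shift3 ((2 * pi) *: axis R j) (shifted _ 0 Le f cf)).
  by apply: eq_Rintegral => p _; rewrite addrK fper.
apply: (addIr (\int[lebesgue3 R]_p (\1_slab p * f p))).
rewrite {2}E2 E1 /mass -!RintegralD//.
- by apply: eq_Rintegral => p _; rewrite -!mulrDl swap.
- exact: integrable_rect.
- exact: shifted.
- exact: shifted.
- exact: integrable_rect.
Qed.

Lemma mass_shift f (j : 'I_3) (e : R) : C_torus f -> `|e| <= 2 * pi ->
  mass (fun p => f (p + e *: axis R j)) = mass f.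
Proof.
move=> fC e2; have [e0|e0] := leP 0 e.
  by apply: mass_shift_ge0 => //; rewrite e0/=; rewrite ger0_norm in e2.
have := mass_shift_ge0 j (C_torus_shift (e *: axis R j) fC) => /(_ (- e)) <-.
  by congr mass; apply/funext => p; rewrite scaleNr subrK.
by rewrite ltr0_norm// in e2; rewrite e2 andbT; lra.
Qed.

Lemma continuous_flux (w V : space3 R -> R) : continuous w -> continuous V ->
  continuous (w \* V^\+) /\ continuous (w \* V^\-).
Proof.
move=> cw cV.
have c0 : continuous (cst 0 : space3 R -> R) by move=> p; exact: cvg_cst.
split=> p; apply: continuousM; try exact: cw.
- by apply: continuous_max; [exact: cV|exact: c0].
- by apply: continuous_max; [apply: continuousN; exact: cV|exact: c0].
Qed.

Lemma C_torus_flux (w V : space3 R -> R) : C_torus w -> C_torus V ->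
  C_torus (w \* V^\+) /\ C_torus (w \* V^\-).
Proof.
move=> [cw wper] [cV Vper]; have [cp cn] := continuous_flux cw cV.
by split; split => // j p; rewrite /= /funrpos /funrneg wper Vper.
Qed.

(** Differences of translates have integral 0 over a period. *)
Lemma mass_transport_rhs (eps : R) (V : 'I_3 -> space3 R -> R)
    (w : space3 R -> R) :
  0 < eps <= 1 -> C_torus w -> (forall j, C_torus (V j)) ->
  mass (transport_rhs eps V w) = 0.
Proof.
move=> /andP[eps0 eps1] wC VC.
have pi2 : 1 <= 2 * pi :> R by have := @pi_ge2 R; lra.
pose F (j : 'I_3) p :=
  ((w \* (V j)^\+) (p - eps *: axis R j) - (w \* (V j)^\+) p) +
  ((w \* (V j)^\-) (p + eps *: axis R j) - (w \* (V j)^\-) p).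
have cont j : continuous (F j) /\ mass (F j) = 0.
  have [pC nC] := C_torus_flux wC (VC j).
  have pC' := C_torus_shift (- (eps *: axis R j)) pC.
  have nC' := C_torus_shift (eps *: axis R j) nC.
  have c1 : continuous (fun p =>
      (w \* (V j)^\+) (p - eps *: axis R j) - (w \* (V j)^\+) p).
    by move=> p; apply: cvgB; [exact: pC'.1|exact: pC.1].
  have c2 : continuous (fun p =>
      (w \* (V j)^\-) (p + eps *: axis R j) - (w \* (V j)^\-) p).
    by move=> p; apply: cvgB; [exact: nC'.1|exact: nC.1].
  split; first by move=> p; apply: cvgD; [exact: c1|exact: c2].
  rewrite /F massD// !massB//; try exact: pC'.1; try exact: nC'.1;
    try exact: pC.1; try exact: nC.1.
  rewrite (mass_shift j nC); last by rewrite gtr0_norm//; lra.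
  rewrite -scaleNr (mass_shift j pC); last by rewrite normrN gtr0_norm//; lra.
  by rewrite !subrr addr0.
pose k1 : 'I_3 := lift ord0 ord0; pose k2 : 'I_3 := lift ord0 (lift ord0 ord0).
have -> : transport_rhs eps V w =
    (fun p => eps^-1 * (F ord0 p + (F k1 p + F k2 p))).
  apply/funext => p; rewrite transport_rhsE; congr (_ * _).
  by rewrite !big_ord_recl big_ord0 addr0.
have c12 : continuous (fun p => F k1 p + F k2 p).
  by move=> p; apply: cvgD; exact: (cont _).1.
rewrite massZ; last by move=> p; apply: cvgD; [exact: (cont _).1|exact: c12].
rewrite (massD (cont _).1 c12) (massD (cont _).1 (cont _).1).
by rewrite !(cont _).2 !addr0 mulr0.
Qed.

End mass.

(** * Conservation of mass *)
Section conservation.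
Context (R : realType).

(** Extending m to negative times by the constant m 0 makes all the derivatives
    two-sided. *)
Lemma zero_slope_cst (m : R -> R) :
  (forall t, 0 <= t ->
    h^-1 * (m (t + h) - m t) @[h --> within [set h | 0 <= t + h] 0^'] -->
      (0 : R)) ->
  forall t, 0 <= t -> m t = m 0.
Proof.
move=> m0 t t0.
pose M (s : R) := m (Num.max s 0).
suff Md (s : R) : is_derive s (1 : R) M 0.
  have := is_derive_0_is_cst t 0 Md; rewrite /M max_l// max_l//.
have cvM : h^-1 *: (M (h *: 1 + s) - M s) @[h --> 0^'] --> (0 : R).
  apply/cvgrPdist_le => e e0.
  have [s0|s0] := leP 0 s; last first.
    have : \forall h \near (0 : R), `|h| < - s.
      apply/nbhs_ballP; exists (- s) => [|h]; rewrite /= ?oppr_gt0//.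
      by rewrite /ball /= sub0r normrN.
    move=> H; apply: cvg_within; apply: filterS H => h hs.
    have hs0 : h + s <= 0 by have := ler_norm h; lra.
    rewrite /M /= [h *: _]mulr1 (max_r hs0) (max_r (ltW s0)) subrr scaler0.
    by rewrite subrr normr0 ltW.
  have /cvgrPdist_le /(_ e e0) := m0 s s0.
  rewrite /dnbhs !near_withinE => H.
  have near_s : \forall h \near (0 : R), s = 0 \/ 0 <= h + s.
    have [s00|s00] := eqVneq s 0.
      by apply/nbhs_ballP; exists 1 => [|h _]; [exact: ltr01|left].
    have {}s0 : 0 < s by rewrite lt_neqAle eq_sym s00.
    apply/nbhs_ballP; exists s => // h; rewrite /ball /= sub0r normrN => hs.
    by right; have := ler_norm (- h); rewrite normrN; lra.
  apply: filterS2 near_s H => h [s00|hs] H h0;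
    rewrite /M /= [h *: 1]mulr1 (max_l s0); last first.
    by rewrite (max_l hs); rewrite addrC in hs *; exact: H.
  have [hs|/ltW hs] := leP 0 (h + s); first by rewrite addrC in hs *; exact: H.
  by rewrite s00 subrr scaler0 subrr normr0 ltW.
split.
- by apply/cvg_ex; exists 0.
- by apply/cvg_lim.
Qed.

Lemma velocity_C_torus (S : 'I_4 -> space3 R -> R) j :
  (forall k, C_torus (S k)) -> (forall p, 0 < S ord0 p) ->
  C_torus (velocity S j).
Proof.
move=> SC S0; split=> [p|i p]; last by rewrite /velocity !(SC _).2.
apply: cvgM; first exact: (SC _).1.
by apply: cvgV; [rewrite gt_eqF|exact: (SC _).1].
Qed.

(** The integral over a cell is a continuous linear form for the sup norm, so it
    can be applied to the difference quotients of the solution. *)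
Lemma mass_conserved (eps : R) S0 (U dU : R -> 'I_4 -> space3 R -> R) k t :
  0 < eps <= 1 -> ode_solution eps S0 U dU -> 0 <= t ->
  mass (U t k) = mass (S0 k).
Proof.
move=> eps01 [UC1 Upos Urhs U0].
have -> : S0 k = U 0 k by apply/funext => p; rewrite U0.
move: t; apply: zero_slope_cst => t t0.
have UC s i : 0 <= s -> C_torus (U s i) by move=> s0; have [] := UC1 i s s0.
have [_ dUC cv _] := UC1 k t t0.
have dU0 : mass (dU t k) = 0.
  have -> : dU t k = transport_rhs eps (velocity (U t)) (U t k).
    by apply/funext => p; exact: Urhs.
  apply: mass_transport_rhs => //; first exact: UC.
  by move=> j; apply: velocity_C_torus => [i|p]; [exact: UC|exact: Upos].
have one_ge0 : 0 <= mass (fun _ : space3 R => 1 : R) by exact: mass_ge0.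
apply/cvgrPdist_le => e e0.
have e1 : 0 < e / (mass (fun _ : space3 R => 1 : R) + 1).
  by rewrite divr_gt0// ltr_wpDl.
have /cvgrPdist_le /(_ _ e1) := cv.
rewrite /dnbhs !near_withinE; apply: filterS => h H h0 th.
have {H} := H h0 th; rewrite !sub0r !normrN ger0_norm ?sup_norm_ge0// => H.
have c1 := (UC _ k th).1; have c0 := (UC _ k t0).1; have c2 := dUC.1.
have cB : continuous (fun p => U (t + h) k p - U t k p).
  by move=> p; apply: cvgB; [exact: c1|exact: c0].
have cZ : continuous (fun p => h^-1 * (U (t + h) k p - U t k p)).
  by move=> p; apply: cvgM; [exact: cvg_cst|exact: cB].
have cg : continuous (fun p => h^-1 * (U (t + h) k p - U t k p) - dU t k p).
  by move=> p; apply: cvgB; [exact: cZ|exact: c2].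
have -> : h^-1 * (mass (U (t + h) k) - mass (U t k)) =
    mass (fun p => h^-1 * (U (t + h) k p - U t k p) - dU t k p).
  by rewrite (massB cZ c2) (massZ _ cB) (massB c1 c0) dU0 subr0.
have [B1 B1P] := C_torus_bounded (UC _ k th).
have [B0 B0P] := C_torus_bounded (UC _ k t0).
have [B2 B2P] := C_torus_bounded dUC.
apply: le_trans (normr_mass_le cg (M := e / (mass (fun=> 1) + 1)) _) _.
  move=> p; apply: le_trans H; apply: le_sup_norm.
  exists (`|h^-1| * (B1 + B0) + B2) => q.
  apply: le_trans (ler_normB _ _) _; apply: lerD => //.
  rewrite normrM ler_wpM2l//; apply: le_trans (ler_normB _ _) _; exact: lerD.
by rewrite mulrAC ler_pdivrMr ?ltr_wpDl// ler_wpM2l ?(ltW e0)//; lra.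
Qed.

End conservation.

(** * Lebesgue norms of continuous functions on the torus *)
Section initial_data.
Context (R : realType).

Lemma torus_measureE (A : set (mspace R)) :
  torus_measure R A = lebesgue3 R (A `&` @cell R).
Proof. by []. Qed.

(** If the open set where M < |f| met the cell, it would contain a box of
    positive measure.  The box has the given point as its lower corner, since
    the cell is only half-open. *)
Lemma ae_le_torus (f : space3 R -> R) (M : R) : C_torus f ->
  {ae torus_measure R, forall p, `|f p| <= M} -> forall p, `|f p| <= M.
Proof.
move=> [cf fper] [N [mN N0 fN]] p0; rewrite leNgt; apply/negP => Mp0.
have [p cp fE] := periodic_cell p0 fper; rewrite fE in Mp0.
have opn : open [set q | M < `|f q|].
  apply: (@open_comp _ _ (fun q => `|f q|) [set y | M < y]); last exact: open_gt.
  by move=> q _; apply: continuous_comp; [exact: cf|exact: norm_continuous].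
have /nbhs_ballP[d /= d0 dP] : nbhs p [set q | M < `|f q|].
  exact: open_nbhs_nbhs.
have [[]] := cp; rewrite /= !in_itv /=.
move=> /andP[x0 x1] /andP[y0 y1] /andP[z0 z1].
pose c := Num.min d
  (Num.min (2 * pi - p.1.1) (Num.min (2 * pi - p.1.2) (2 * pi - p.2))).
have c0 : 0 < c by rewrite !lt_min d0 !subr_gt0 x1 y1 z1.
have [cd cx cy cz] : [/\ c <= d, c <= 2 * pi - p.1.1,
    c <= 2 * pi - p.1.2 & c <= 2 * pi - p.2].
  by rewrite /c !ge_min !lexx !orbT.
pose Q := rect p (p + (c, c, c)).
have QN : Q `<=` N `&` @cell R.
  move=> [[x y] z] [[/=]]; rewrite !in_itv /=.
  move=> /andP[hx kx] /andP[hy ky] /andP[hz kz].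
  split; last first.
    by split; [split|] => /=; rewrite in_itv /=; apply/andP; split; lra.
  apply: fN => /=; apply/negP; rewrite -ltNge; apply: dP.
  by split; [split|] => /=; rewrite /ball /= ltr_norml; lra.
have : (lebesgue3 R Q <= torus_measure R N)%E.
  rewrite torus_measureE; apply: le_measure => //; rewrite inE.
    exact: measurable_rect.
  by apply: measurableI => //; exact: measurable_cell.
have lt_c (u : R) : u < u + c by lra.
rewrite N0 lebesgue3_rect; [|exact: lt_c|exact: lt_c|exact: lt_c].
rewrite lee_fin leNgt => /negP; apply.
by rewrite !mulr_gt0// subr_gt0; exact: lt_c.
Qed.

Lemma le_cell_torus_integral (g : mspace R -> \bar R) :
  measurable_fun setT g -> (forall p, 0 <= g p)%E ->
  (\int[lebesgue3 R]_(p in @cell R) g p <= \int[torus_measure R]_p g p)%E.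
Proof.
move=> mg g0.
have -> : (\int[lebesgue3 R]_(p in @cell R) g p =
    \int[torus_measure R]_(p in @cell R) g p)%E.
  apply: eq_measure_integral => A mA Acell.
  by rewrite torus_measureE setIidl.
apply: ge0_subset_integral => //; first exact: measurable_cell.
Qed.

Lemma mass_le_L1 (f : space3 R -> R) : continuous f ->
  ((mass f)%:E <= L_torus_norm 1 f)%E.
Proof.
move=> cf; rewrite /L_torus_norm Lnorm1.
have mf := continuous_measurable3 cf.
have fi := integrable_rect (0 : space3 R) (period R) cf.
apply: le_trans (le_cell_torus_integral _ _) => //; last first.
  by apply: measurableT_comp => //; exact/measurable_EFinP.
rewrite /mass /Rintegral fineK; last exact: integrable_fin_num.
rewrite [leRHS]integral_mkcond; apply: le_integral => //.
  have := integrable_abse fi; congr (_.-integrable _ _).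
  apply/funext => p; rewrite /patch /= indicE.
  by case: ifP => _; rewrite ?mul1r ?mul0r ?normr0.
move=> p _; rewrite /patch /= indicE.
by case: ifP => _; rewrite ?mul1r ?mul0r // lee_fin ler_norm.
Qed.

End initial_data.

Section initial_bounds.
Context (R : realType).

Lemma torus_measure_gt0 : (0 < torus_measure R setT)%E.
Proof.
rewrite torus_measureE setTI -rect_cell lebesgue3_rect ?pi2_gt0//=.
by rewrite lte_fin !subr0 !mulr_gt0// pi_gt0.
Qed.

Lemma sup_le_Linfty (f : space3 R -> R) (M : R) : C_torus f ->
  (L_torus_norm +oo f <= M%:E)%E -> forall p, `|f p| <= M.
Proof.
move=> fC; rewrite /L_torus_norm unlock torus_measure_gt0 => H.
apply: ae_le_torus => //; move/ess_supP : H; apply: filterS => p.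
by rewrite /= lee_fin.
Qed.

(** By Minkowski's inequality, a convergent family is eventually bounded. *)
Lemma L_torus_norm_bounded (q : \bar R) (f : space3 R -> R)
    (fe : R -> space3 R -> R) : (1 <= q)%E ->
  L_torus q f -> (forall eps, 0 < eps <= 1 -> C_torus (fe eps)) ->
  (L_torus_norm q (fun p => fe eps p - f p) @[eps --> 0^'+] --> 0%E) ->
  exists C : R, \forall eps \near 0^'+, 0 < eps <= 1 ->
    (L_torus_norm q (fe eps) <= C%:E)%E.
Proof.
move=> q1 [fL _] feC /fine_cvgP[fin /cvgrPdist_le /(_ 1 ltr01) cv].
have mf : measurable_fun setT (f : mspace R -> R).
  by have := sub_Lfun_mfun fL; rewrite inE.
have Nf : L_torus_norm q f \is a fin_num.
  have := sub_Lfun_finLfun fL; rewrite inE /= /finite_norm => H.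
  by rewrite ge0_fin_numE// Lnorm_ge0.
exists (fine (L_torus_norm q f) + 1).
apply: filterS2 fin cv => eps fin cv eps01.
have mfe := continuous_measurable3 (feC eps eps01).1.
have -> : fe eps = (f \+ (fun p => fe eps p - f p))%R.
  by apply/funext => p /=; rewrite addrC subrK.
rewrite EFinD fineK//; apply: le_trans (eminkowski _ mf _ q1) _.
  exact: measurable_funB.
apply: leeD2l.
have : (L_torus_norm q (fun p => (fe eps p - f p)%R) <= 1%:E)%E; last exact.
rewrite -(fineK fin) lee_fin.
by move: cv; rewrite sub0r normrN; apply: le_trans; exact: ler_norm.
Qed.

Lemma L_torus_normB (q : \bar R) (f g : space3 R -> R) :
  L_torus_norm q (fun p => f p - g p) = L_torus_norm q (fun p => g p - f p).
Proof.
rewrite /L_torus_norm -oppe_Lnorm; congr Lnorm; apply/funext => p /=.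
by rewrite opprB.
Qed.

End initial_bounds.

(** * Covering a box by period cells *)
Section tiling.
Context (R : realType).

Lemma Rintegral_sum_seq (I : Type) (s : seq I) (g : I -> mspace R -> R) :
  (forall i, (lebesgue3 R).-integrable setT (EFin \o g i)) ->
  (lebesgue3 R).-integrable setT (EFin \o (fun p => \sum_(i <- s) g i p)) /\
  \int[lebesgue3 R]_p (\sum_(i <- s) g i p) =
    \sum_(i <- s) \int[lebesgue3 R]_p g i p.
Proof.
move=> gi; elim: s => [|i s [IH1 IH2]].
  have E : (fun p : mspace R => \sum_(i <- [::]) g i p) = cst 0.
    by apply/funext => p; rewrite big_nil.
  rewrite E big_nil; split; first exact: integrable0.
  by rewrite Rintegral_cst// mul0r.
have E : (fun p : mspace R => \sum_(i <- i :: s) g i p) =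
    (fun p => g i p + \sum_(i <- s) g i p).
  by apply/funext => p; rewrite big_cons.
rewrite E; split.
  exact: (integrableD measurableT (gi i) IH1).
by rewrite RintegralD// IH2 big_cons.
Qed.

Definition big_box (N : nat) : set (mspace R) :=
  rect (- (N%:R * (2 * pi)), - (N%:R * (2 * pi)), - (N%:R * (2 * pi)))
       (N%:R * (2 * pi), N%:R * (2 * pi), N%:R * (2 * pi)).

Lemma tile_index (N : nat) (x : R) :
  - (N%:R * (2 * pi)) <= x < N%:R * (2 * pi) ->
  exists k : 'I_(2 * N), 0 <= x - (k%:R - N%:R) * (2 * pi) < 2 * pi.
Proof.
move=> /andP[x0 x1]; have pi0 := pi2_gt0 R.
pose n := Num.floor (x / (2 * pi)).
have /andP[n0 n1] := floor_itv (x / (2 * pi)); rewrite -/n in n0 n1.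
have h0 : - N%:R <= x / (2 * pi) by rewrite ler_pdivlMr// mulNr.
have h1 : x / (2 * pi) < N%:R by rewrite ltr_pdivrMr.
have nN : (- N%:Z <= n)%R.
  by rewrite -ltzD1 -(ltr_int R) mulrNz; apply: le_lt_trans h0 n1.
have nN' : (n < N%:Z)%R by rewrite -(ltr_int R); apply: le_lt_trans n0 h1.
have [m nE] : exists m : nat, (n + N%:Z)%R = m%:Z.
  by exists `|(n + N%:Z)%R|%N; rewrite gez0_abs//; lra.
have mN : (m < 2 * N)%N.
  by rewrite -ltz_nat -nE PoszM; lra.
exists (Ordinal mN) => /=.
have -> : m%:R - N%:R = n%:~R :> R.
  have : (n + N%:Z)%R%:~R = m%:R :> R by rewrite nE.
  by rewrite intrD => <-; rewrite addrK.
move: n0 n1; rewrite ler_pdivlMr// intrD ltr_pdivrMr// mulrDl mul1r; lra.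
Qed.

(** The box is covered by (2 N)^3 translates of the cell, and a periodic
    function has the same integral on each of them. *)
Lemma integral_big_box_le (N : nat) (f : space3 R -> R) : C_torus f ->
  (forall p, 0 <= f p) ->
  \int[lebesgue3 R]_p (\1_(big_box N) p * f p) <= (2 * N)%:R ^+ 3 * mass f.
Proof.
move=> [cf fper] f0.
pose I := ('I_(2 * N) * 'I_(2 * N) * 'I_(2 * N))%type.
pose L (i : I) := lattice R (i.1.1%:Z - N%:Z) (i.1.2%:Z - N%:Z) (i.2%:Z - N%:Z).
pose g (i : I) (p : mspace R) : R :=
  \1_(rect (0 : space3 R) (period R)) (p - L i) * f p.
have gi i : (lebesgue3 R).-integrable setT (EFin \o g i).
  have := integrable_shift3 (- L i)
    (integrable_rect (0 : space3 R) (period R) (continuous_shift (a := L i) cf)).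
  by congr (_.-integrable _ _); apply/funext => p /=; rewrite subrK.
have gE i : \int[lebesgue3 R]_p g i p = mass f.
  rewrite -(Rintegral_shift3 (L i) (gi i)) /mass.
  by apply: eq_Rintegral => p _; rewrite /g addrK periodic_lattice.
have [si sE] := Rintegral_sum_seq (index_enum I) gi.
apply: le_trans (_ : \int[lebesgue3 R]_p (\sum_i g i p) <= _).
  apply: le_Rintegral => //; first exact: integrable_rect.
  move=> p _; rewrite rect_indicE.
  have g0 i : 0 <= g i p by rewrite mulr_ge0// indicE.
  case: and3P => [[/= h1 h2 h3]|_]; last by rewrite mul0r sumr_ge0.
  have [k1 e1] := tile_index h1; have [k2 e2] := tile_index h2.
  have [k3 e3] := tile_index h3.
  rewrite (bigD1 (k1, k2, k3))//= -[leLHS]addr0 lerD ?sumr_ge0//.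
  rewrite /g rect_indicE /L /lattice /= !intrB.
  by rewrite (_ : [&& _, _ & _] = true)//; apply/and3P; split.
rewrite sE (eq_bigr (fun=> mass f)); last by move=> i _; rewrite gE.
rewrite sumr_const !card_prod !card_ord -[mass f *+ _]mulr_natl -natrX.
by rewrite !expnS expn0 muln1 -!mulnA.
Qed.

End tiling.

(** * Test functions *)
Section test_functions.
Context (R : realType).

Lemma is_derive_line (psi : space3 R -> R) (p a : space3 R) (s : R) :
  derivable psi (p + s *: a) a ->
  is_derive s 1 (fun s : R => psi (p + s *: a)) ('D_a psi (p + s *: a)).
Proof.
move=> dpsi.
have E : (fun h : R => h^-1 *:
      (((fun s : R => psi (p + s *: a)) \o shift s) (h *: 1)
        - psi (p + s *: a))) =
    (fun h : R => h^-1 *: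
      ((psi \o shift (p + s *: a)) (h *: a) - psi (p + s *: a))).
  apply/funext => h /=; congr (_ *: (psi _ - _)).
  by rewrite [h *: _]mulr1 scalerDl addrCA.
split; first by rewrite /derivable E.
by rewrite /derive E.
Qed.

(** Both signs of e occur, as the fluxes go both ways along each axis. *)
Lemma MVT_origin (f df : R -> R) (e : R) :
  (forall x : R, is_derive x 1 f (df x)) ->
  exists2 c, `|c| <= `|e| & f e - f 0 = df c * e.
Proof.
move=> fd.
have cont a b : {within `[a, b], continuous f}.
  by apply: continuous_subspaceT => x; exact: is_derive_continuous (fd x).
have [e0|e0] := leP 0 e.
  have [c] := MVT_segment e0 (fun x _ => fd x) (cont _ _).
  rewrite in_itv /= => /andP[c0 ce] ->; exists c; last by rewrite subr0.
  by rewrite !ger0_norm.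
have [c] := MVT_segment (ltW e0) (fun x _ => fd x) (cont _ _).
rewrite in_itv /= => /andP[c0 ce] E; exists c.
  by rewrite !ler0_norm ?lerN2// ltW.
by rewrite -opprB E sub0r mulrN opprK.
Qed.

Lemma normr_axis (j : 'I_3) (e : R) : `|e *: axis R j| <= `|e|.
Proof.
rewrite normrZ ler_piMr// /axis !prod_normE /=.
by rewrite !ge_max !ger0_norm ?ler0n// !lern1 !leq_b1.
Qed.

Lemma big_box_norm (N : nat) (p : space3 R) : ~ big_box N p -> N%:R <= `|p|.
Proof.
move=> pB; rewrite leNgt; apply/negP => pN; apply: pB.
have pi1 : 1 <= 2 * pi :> R by have := @pi_ge2 R; lra.
have Npi : N%:R <= N%:R * (2 * pi) :> R by rewrite ler_peMr.
move: pN; rewrite !prod_normE /= !gt_max => /andP[/andP[]].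
rewrite !ltr_norml => /andP[x0 x1] /andP[y0 y1] /andP[z0 z1].
by split; [split|] => /=; rewrite in_itv /=; apply/andP; split; lra.
Qed.

Lemma test_function_support (psi : space3 R -> R) : test_function psi ->
  exists2 A : R, 0 <= A & forall p, A < `|p| -> psi p = 0.
Proof.
move=> [_ /compact_bounded[M [_ MP]]].
exists (`|M| + 1) => [|p Ap]; first by rewrite addr_ge0.
apply/eqP; apply: contraTT Ap => psip; rewrite -leNgt; apply: MP.
  by have := ler_norm M; lra.
exact: subset_closure.
Qed.

(** The box contains the support of psi enlarged by 1, hence all the shifts by
    |e| <= 1, and C bounds the second derivatives on a cube that contains the
    segments along which the Taylor formula is used. *)
Lemma test_function_taylor (psi : space3 R -> R) : test_function psi ->
  exists (N : nat) (C : R), [/\ 0 <= C,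
    forall p j e, ~ big_box N p -> `|e| <= 1 ->
      psi (p + e *: axis R j) = 0 /\ 'D_(axis R j) psi p = 0 &
    forall p j e, `|e| <= 1 ->
      `|psi (p + e *: axis R j) - psi p - e * 'D_(axis R j) psi p| <= C * e ^+ 2].
Proof.
move=> psiT; have [A A0 AP] := test_function_support psiT.
have [sm _] := psiT.
have far p j e : A + 1 < `|p| -> `|e| <= 1 ->
    psi (p + e *: axis R j) = 0 /\ 'D_(axis R j) psi p = 0.
  move=> Ap e1; split.
    apply: AP; have := normr_axis j e.
    have := lerB_normD p (e *: axis R j); lra.
  have -> : 'D_(axis R j) psi p = 'D_(axis R j) (cst 0) p.
    apply: near_eq_derive.
    have opn : open [set q : space3 R | A < `|q|].
      apply: (@open_comp _ _ (fun q : space3 R => `|q|) [set y | A < y]);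
        last exact: open_gt.
      by move=> q _; exact: norm_continuous.
    have : nbhs p [set q : space3 R | A < `|q|].
      by apply: open_nbhs_nbhs; split => //=; lra.
    by apply: filterS => q /AP.
  by rewrite derive_cst.
have d1 j p : derivable psi p (axis R j) by have [_ /(_ j p)] := sm [::].
have d2 j p : derivable ('D_(axis R j) psi) p (axis R j).
  by have [_ /(_ j p)] := sm [:: j].
have /choice[B BP] : forall j, exists B, forall q, cube (- (A + 2)) (A + 2) q ->
    `|'D_(axis R j) ('D_(axis R j) psi) q| <= B.
  move=> j; apply: compact_continuous_bounded; first exact: compact_cube.
  by have [] := sm [:: j; j].
pose C := \sum_j `|B j|.
exists (Num.truncn (A + 1)).+1, C; split.
- exact: sumr_ge0.
- move=> p j e /big_box_norm pN e1; apply: far => //.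
  by apply: lt_le_trans pN; exact: truncnS_gt.
move=> p j e e1.
have [pA|pA] := ltP (A + 1) `|p|.
  have [-> ->] := far p j e pA e1.
  have [] := far p j 0 pA _; first by rewrite normr0.
  rewrite scale0r addr0 => -> _; rewrite mulr0 !subr0 normr0 mulr_ge0 ?sqr_ge0//.
  exact: sumr_ge0.
pose f (s : R) := psi (p + s *: axis R j).
pose df (s : R) := 'D_(axis R j) psi (p + s *: axis R j).
pose ddf (s : R) := 'D_(axis R j) ('D_(axis R j) psi) (p + s *: axis R j).
have fd (s : R) : is_derive s 1 f (df s) by apply: is_derive_line.
have dfd (s : R) : is_derive s 1 df (ddf s) by apply: is_derive_line.
have [c ce E1] := MVT_origin e fd; have [d dc E2] := MVT_origin c dfd.
have -> : psi (p + e *: axis R j) - psi p - e * 'D_(axis R j) psi p =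
    ddf d * c * e.
  rewrite -E2 mulrBl -E1 /f /df scale0r addr0; ring.
have ddfC : `|ddf d| <= C.
  apply: le_trans (BP j _ _) _.
    have : `|p + d *: axis R j| <= A + 2.
      apply: le_trans (ler_normD _ _) _; have := normr_axis j d; lra.
    rewrite !prod_normE /= !ge_max => /andP[/andP[]].
    rewrite !ler_norml => h1 h2 h3.
    by split; [split|] => /=; rewrite in_itv.
  apply: le_trans (ler_norm _) _.
  by rewrite /C (bigD1 j)//= lerDl sumr_ge0.
rewrite !normrM -[e ^+ 2]ger0_norm ?sqr_ge0// normrX expr2 mulrA.
by rewrite ler_wpM2r// ler_pM.
Qed.

End test_functions.

(** * The weak residual *)
Section residual.
Context (R : realType) (psi : space3 R -> R) (psiT : test_function psi).

Let cpsi : continuous psi. Proof. by have [/(_ [::])[]] := psiT. Qed.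

Let cdpsi j : continuous ('D_(axis R j) psi).
Proof. by have [/(_ [:: j])[]] := psiT. Qed.

Lemma integrable_supported (h : space3 R -> R) (a b : space3 R) :
  continuous h -> (forall p, ~ rect a b p -> h p = 0) ->
  (lebesgue3 R).-integrable setT (EFin \o h).
Proof.
move=> ch h0; have := integrable_rect a b ch.
congr (_.-integrable _ _); apply/funext => p /=; rewrite indicE.
case: (boolP (p \in rect a b)) => [_|/negP pB]; first by rewrite mul1r.
by rewrite mul0r h0// => /mem_set.
Qed.

(** The contribution of one directional flux F to eps times the integrand of the
    residual: e = eps for (w V_j)^+ moving upwards along the axis j, and
    e = - eps for the flux moving downwards. *)
Definition residual_term (F : space3 R -> R) (j : 'I_3) (e : R) :
    space3 R -> R :=
  fun p => F (p - e *: axis R j) * psi p - F p * psi p -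
    e * (F p * 'D_(axis R j) psi p).

(** Translating the variable moves the shift from F, which has no regularity
    uniform in eps, to psi, where the Taylor formula applies. *)
Lemma residual_term_bound (N : nat) (C : R) (F G : space3 R -> R) j e :
  (forall p j e, ~ big_box N p -> `|e| <= 1 ->
      psi (p + e *: axis R j) = 0 /\ 'D_(axis R j) psi p = 0) ->
  (forall p j e, `|e| <= 1 ->
    `|psi (p + e *: axis R j) - psi p - e * 'D_(axis R j) psi p| <= C * e ^+ 2) ->
  0 <= C -> `|e| <= 1 ->
  continuous F -> C_torus G -> (forall p, `|F p| <= G p) ->
  (lebesgue3 R).-integrable setT (EFin \o residual_term F j e) /\
  `|\int[lebesgue3 R]_p residual_term F j e p| <=
    C * e ^+ 2 * ((2 * N)%:R ^+ 3 * mass G).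
Proof.
move=> supp taylor C0 e1 cF [cG Gper] FG.
set a := e *: axis R j.
have G0 p : 0 <= G p by exact: le_trans (normr_ge0 _) (FG p).
have psi0 p : ~ big_box N p -> psi p = 0.
  move=> pB; have [] := supp p j 0 pB _; first by rewrite normr0.
  by rewrite scale0r addr0.
have cpsia := continuous_shift (a := a) cpsi.
have c1 : continuous (fun p => F p * psi (p + a)).
  by move=> p; apply: cvgM; [exact: cF|exact: cpsia].
have c2 : continuous (fun p => F p * psi p).
  by move=> p; apply: cvgM; [exact: cF|exact: cpsi].
have c3 : continuous (fun p => e * (F p * 'D_(axis R j) psi p)).
  move=> p; apply: cvgM; first exact: cvg_cst.
  by apply: cvgM; [exact: cF|exact: cdpsi].
have i1 : (lebesgue3 R).-integrable setT (EFin \o (fun p => F p * psi (p + a))).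
  apply: integrable_supported c1 _ => p /supp/(_ e1) pB.
  by rewrite (pB j).1 mulr0.
have i2 : (lebesgue3 R).-integrable setT (EFin \o (fun p => F p * psi p)).
  by apply: integrable_supported c2 _ => p /psi0 ->; rewrite mulr0.
have i3 : (lebesgue3 R).-integrable setT
    (EFin \o (fun p => e * (F p * 'D_(axis R j) psi p))).
  apply: integrable_supported c3 _ => p /supp/(_ e1) pB.
  by rewrite (pB j).2 !mulr0.
have i1' : (lebesgue3 R).-integrable setT
    (EFin \o (fun p => F (p - a) * psi p)).
  have := integrable_shift3 (- a) i1.
  by congr (_.-integrable _ _); apply/funext => p /=; rewrite subrK.
have E1 : \int[lebesgue3 R]_p (F (p - a) * psi p) =
    \int[lebesgue3 R]_p (F p * psi (p + a)).
  rewrite -(Rintegral_shift3 (- a) i1).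
  by apply: eq_Rintegral => p _; rewrite subrK.
have i12 := integrableB measurableT i1' i2.
have i123 : (lebesgue3 R).-integrable setT (EFin \o residual_term F j e).
  exact: (integrableB measurableT i12 i3).
split => //.
have j12 := integrableB measurableT i1 i2.
have j123 : (lebesgue3 R).-integrable setT (EFin \o (fun p =>
    F p * (psi (p + a) - psi p - e * 'D_(axis R j) psi p))).
  have := integrableB measurableT j12 i3; congr (_.-integrable _ _).
  by apply/funext => p /=; congr (_%:E); ring.
have -> : \int[lebesgue3 R]_p residual_term F j e p =
    \int[lebesgue3 R]_p (F p * (psi (p + a) - psi p - e * 'D_(axis R j) psi p)).
  rewrite /residual_term (RintegralB measurableT i12 i3).
  rewrite (RintegralB measurableT i1' i2) E1.
  rewrite -(RintegralB measurableT i1 i2) -(RintegralB measurableT j12 i3).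
  by apply: eq_Rintegral => p _; ring.
apply: le_trans (le_normr_Rintegral measurableT j123) _.
have iG : (lebesgue3 R).-integrable setT
    (EFin \o (fun p => \1_(big_box N) p * G p)) by exact: integrable_rect.
apply: le_trans (_ : \int[lebesgue3 R]_p
    (C * e ^+ 2 * (\1_(big_box N) p * G p)) <= _).
  apply: le_Rintegral => //.
  - exact: integrable_abse j123.
  - exact: (integrableZl measurableT (C * e ^+ 2) iG).
  - move=> p _; rewrite normrM indicE.
    case: (boolP (p \in big_box N)) => [_|/negP pB].
      by rewrite mul1r [leRHS]mulrC ler_pM//; exact: taylor.
    have nB : ~ big_box N p by move=> /mem_set.
    have [-> ->] := supp p j e nB e1; rewrite (psi0 p nB).
    by rewrite !mulr0 !subr0 normr0 !mul0r !mulr0.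
rewrite RintegralZl// ler_wpM2l//; first by rewrite (mulr_ge0 C0 (sqr_ge0 e)).
exact: (integral_big_box_le N (conj cG Gper) G0).
Qed.

(** Each of the 6 directional fluxes contributes O(eps^2) before the division by
    eps.  The constant K depends on psi only: the state enters through M and its
    mass. *)
Lemma weak_residual_bound : exists2 K : R, 0 <= K &
  forall (eps M : R) (S : 'I_4 -> space3 R -> R) (dw : space3 R -> R) k,
  0 < eps <= 1 -> 1 <= M -> (forall k, C_torus (S k)) ->
  (forall p, 0 < S ord0 p) -> (forall k p, `|S k p| <= M * S ord0 p) ->
  (forall p, dw p = transport_rhs eps (velocity S) (S k) p) ->
  `|weak_residual dw (S k) (velocity S) psi| <= K * M ^+ 2 * mass (S ord0) * eps.
Proof.
have [N [C [C0 supp taylor]]] := test_function_taylor psiT.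
pose K := 6 * C * (2 * N)%:R ^+ 3.
exists K; first by rewrite /K !mulr_ge0 ?exprn_ge0.
move=> eps M S dw k /andP[eps0 eps1] M1 SC S0 SM dwE.
have cS : cone M S by split => // p; exact: ltW.
have VC j := velocity_C_torus j SC S0.
pose F j := (S k \* (velocity S j)^\+).
pose G j := (S k \* (velocity S j)^\-).
pose T (i : 'I_3 * bool) := if i.2 then residual_term (F i.1) i.1 eps
  else residual_term (G i.1) i.1 (- eps).
pose H p := M ^+ 2 * S ord0 p.
have HC : C_torus H.
  split=> [p|i p]; last by rewrite /H (SC _).2.
  by apply: cvgM; [exact: cvg_cst|exact: (SC _).1].
have bnd w V p : `|V| <= M -> `|w| <= M * S ord0 p ->
    `|w * Num.max V 0| <= H p.
  move=> VM wM; rewrite normrM /H expr2 -mulrA mulrC ler_pM//.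
  exact: le_trans (normr_max0 _) VM.
have FH j p : `|F j p| <= H p by apply: bnd => //; exact: velocity_cone.
have GH j p : `|G j p| <= H p.
  by apply: bnd => //; rewrite normrN; exact: velocity_cone.
have TB i : (lebesgue3 R).-integrable setT (EFin \o T i) /\
    `|\int[lebesgue3 R]_p T i p| <= C * eps ^+ 2 * ((2 * N)%:R ^+ 3 * mass H).
  have [cF cG] := continuous_flux (SC k).1 (VC i.1).1.
  rewrite /T; case: ifP => _.
    by apply: residual_term_bound => //; rewrite gtr0_norm.
  rewrite -sqrrN; apply: residual_term_bound => //.
  by rewrite normrN gtr0_norm.
have [Ti TE] := Rintegral_sum_seq (index_enum ('I_3 * bool)%type)
  (fun i => (TB i).1).
have -> : weak_residual dw (S k) (velocity S) psi =
    eps^-1 * \sum_i \int[lebesgue3 R]_p T i p.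
  rewrite -TE -RintegralZl//; apply: eq_Rintegral => p _.
  have -> : \sum_i T i p = \sum_(j < 3) (T (j, true) p + T (j, false) p).
    rewrite -(pair_bigA _ (fun j b => T (j, b) p)) /=.
    by apply: eq_bigr => j _; rewrite big_bool.
  rewrite dwE transport_rhsE !mulr_sumr mulr_suml -sumrB.
  apply: eq_bigr => j _; rewrite /T /residual_term /= scaleNr opprK.
  have VE : velocity S j p = (velocity S j)^\+ p - (velocity S j)^\- p.
    by rewrite -[in LHS](funrposBneg (velocity S j)).
  rewrite [in X in _ - X = _]VE /F /G /=; field.
  exact: lt0r_neq0.
have cS0 : continuous (S ord0) := (SC ord0).1.
have -> : K * M ^+ 2 * mass (S ord0) * eps =
    eps^-1 * \sum_(i : 'I_3 * bool) (C * eps ^+ 2 * ((2 * N)%:R ^+ 3 * mass H)).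
  rewrite sumr_const card_prod card_ord card_bool -[_ *+ _]mulr_natl.
  rewrite /H massZ// /K; field; exact: lt0r_neq0.
rewrite normrM gtr0_norm ?invr_gt0// ler_wpM2l ?invr_ge0 ?(ltW eps0)//.
apply: le_trans (ler_norm_sum _ _ _) _; apply: ler_sum => i _.
exact: (TB i).2.
Qed.

End residual.

(** * The weak asymptotic method *)
Section solution_family.
Context (R : realType).

(** The summand 1 makes the bound at least 1, as the estimates on the cone
    require. *)
Definition velocity_bound (u : 'I_3 -> space3 R -> R) : R :=
  1 + \sum_j sup_norm (u j).

Lemma velocity_bound_ge1 u : 1 <= velocity_bound u.
Proof. by rewrite lerDl sumr_ge0// => j _; exact: sup_norm_ge0. Qed.

Lemma le_velocity_bound u j p : (forall j, C_torus (u j)) ->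
  `|u j p| <= velocity_bound u.
Proof.
move=> uC; apply: le_trans (le_sup_norm p (C_torus_bounded (uC j))) _.
rewrite /velocity_bound (bigD1 j)//= addrCA lerDl addr_ge0// sumr_ge0// => i _.
exact: sup_norm_ge0.
Qed.

Lemma velocity_bound_le u (B : 'I_3 -> R) :
  (forall j p, `|u j p| <= B j) -> velocity_bound u <= 1 + \sum_j B j.
Proof.
by move=> uB; rewrite lerD2l; apply: ler_sum => j _; exact: sup_norm_le.
Qed.

Lemma initial_state_solution (eps : R) (r0 : space3 R -> R)
    (u0 : 'I_3 -> space3 R -> R) : 0 < eps ->
  C_torus r0 -> (forall p, 0 < r0 p) -> (forall j, C_torus (u0 j)) ->
  exists UdU : (R -> 'I_4 -> space3 R -> R) * (R -> 'I_4 -> space3 R -> R),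
    ode_solution eps (initial_state r0 u0) UdU.1 UdU.2 /\
    forall t k p, 0 <= t ->
      `|UdU.1 t k p| <= velocity_bound u0 * UdU.1 t ord0 p.
Proof.
move=> eps0 rC r0_gt0 uC; have M1 := velocity_bound_ge1 u0.
have init0 : initial_state r0 u0 ord0 = r0.
  by apply/funext => p; rewrite /initial_state unlift_none.
have initS j : initial_state r0 u0 (lift ord0 j) = r0 \* u0 j.
  by apply/funext => p; rewrite /initial_state liftK.
have [|||U [dU [UdU UM]]] :=
  @ode_solution_exists R eps _ eps0 M1 (initial_state r0 u0).
- move=> k; case: (unliftP ord0 k) => [j|] ->; last by rewrite init0.
  rewrite initS; split=> [p|i p]; last by rewrite /= rC.2 (uC j).2.
  by apply: cvgM; [exact: rC.1|exact: (uC j).1].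
- by move=> p; rewrite init0.
- move=> k p; case: (unliftP ord0 k) => [j|] ->; rewrite init0; last first.
    by rewrite gtr0_norm// ler_peMl// ltW.
  rewrite initS /= normrM gtr0_norm// mulrC (ler_wpM2r (ltW (r0_gt0 p)))//.
  exact: le_velocity_bound.
by exists (U, dU).
Qed.

End solution_family.

Theorem theorem2 (R : realType)
    (rho0 : space3 R -> R) (u0 : 'I_3 -> space3 R -> R)
    (rho0e : R -> space3 R -> R) (u0e : R -> 'I_3 -> space3 R -> R)
    (rho0_L1 : L_torus 1 rho0)
    (rho0_ge0 : {ae torus_measure R, forall p, 0 <= rho0 p})
    (u0_Loo : forall j, L_torus +oo (u0 j))
    (rho0e_cont : forall eps, 0 < eps <= 1 -> C_torus (rho0e eps))
    (u0e_cont : forall eps j, 0 < eps <= 1 -> C_torus (u0e eps j))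
    (rho0e_ge : forall eps p, 0 < eps <= 1 -> eps <= rho0e eps p)
    (rho0e_cvg :
      L_torus_norm 1 (fun p => rho0 p - rho0e eps p) @[eps --> 0^'+] --> 0%E)
    (u0e_cvg : forall j,
      L_torus_norm +oo (fun p => u0e eps j p - u0 j p) @[eps --> 0^'+] --> 0%E) :
  exists U dU : R -> R -> 'I_4 -> space3 R -> R,
    (forall eps, 0 < eps <= 1 ->
       ode_solution eps (initial_state (rho0e eps) (u0e eps))
         (U eps) (dU eps)) /\
    weak_asymptotic_order1 U dU.
Proof.
(* The solution is chosen together with its bound on velocities: this bound is
   computed from the initial data, so it is controlled as eps tends to 0. *)
pose curve : Type := R -> 'I_4 -> space3 R -> R.
pose good eps (UdU : curve * curve) :=
  ode_solution eps (initial_state (rho0e eps) (u0e eps)) UdU.1 UdU.2 /\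
  forall t k p, 0 <= t ->
    `|UdU.1 t k p| <= velocity_bound (u0e eps) * UdU.1 t ord0 p.
have /choice[sol solP] : forall eps, exists UdU, 0 < eps <= 1 -> good eps UdU.
  move=> eps; have [eps01|neps] := boolP (0 < eps <= 1); last first.
    by exists (fun=> fun=> fun=> 0, fun=> fun=> fun=> 0).
  have eps0 : 0 < eps by case/andP: eps01.
  have r0 p : 0 < rho0e eps p by exact: lt_le_trans (rho0e_ge eps p eps01).
  have [UdU H] := initial_state_solution eps0 (rho0e_cont eps eps01) r0
    (fun j => u0e_cont eps j eps01).
  by exists UdU.
exists (fun eps => (sol eps).1), (fun eps => (sol eps).2); split.
  by move=> eps /solP[].
move=> psi t k psiT t0.
have [K K0 KP] := weak_residual_bound psiT.
have rho_cvg :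
    L_torus_norm 1 (fun p => rho0e eps p - rho0 p) @[eps --> 0^'+] --> 0%E.
  by under eq_fun do rewrite L_torus_normB.
have [Cr nearCr] := L_torus_norm_bounded (lexx 1%E) rho0_L1 rho0e_cont rho_cvg.
have /choice[Cu nearCu] : forall j, exists C : R, \forall eps \near 0^'+,
    0 < eps <= 1 -> (L_torus_norm +oo (u0e eps j) <= C%:E)%E.
  by move=> j; apply: L_torus_norm_bounded (u0_Loo j) _ (u0e_cvg j);
    rewrite ?leey// => eps; exact: u0e_cont.
have near_u : \forall eps \near 0^'+, forall j,
    0 < eps <= 1 -> (L_torus_norm +oo (u0e eps j) <= (Cu j)%:E)%E.
  exact: (@filter_forall _ _ (fun j eps => 0 < eps <= 1 ->
    (L_torus_norm +oo (u0e eps j) <= (Cu j)%:E)%E) 0^'+ _ nearCu).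
pose M := 1 + \sum_j Cu j.
apply/eqO_exP; exists (K * M ^+ 2 * `|Cr| + 1).
  by rewrite ltr_wpDl// mulr_ge0// mulr_ge0// sqr_ge0.
have near01 : \forall eps \near (0 : R)^'+, 0 < eps <= 1.
  near=> eps; apply/andP; split; near: eps.
    exact: nbhs_right_gt.
  exact: nbhs_right_le.
near=> eps.
have eps01 : 0 < eps <= 1 by near: eps.
have eps0 : 0 < eps by case/andP: eps01.
have /(_ eps01) Hr : 0 < eps <= 1 ->
  (L_torus_norm 1 (rho0e eps) <= Cr%:E)%E by near: eps.
have Hu : forall j, 0 < eps <= 1 ->
  (L_torus_norm +oo (u0e eps j) <= (Cu j)%:E)%E by near: eps.
have [odeU UM] := solP eps eps01.
have [UC1 Upos Urhs _] := odeU.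
have UC i : C_torus ((sol eps).1 t i) by have [] := UC1 i t t0.
have M1 := velocity_bound_ge1 (u0e eps).
have MM : velocity_bound (u0e eps) <= M.
  apply: velocity_bound_le => j p.
  exact: sup_le_Linfty (u0e_cont eps j eps01) (Hu j eps01) p.
have mass_le : mass ((sol eps).1 t ord0) <= `|Cr|.
  rewrite (mass_conserved ord0 eps01 odeU t0).
  have -> : initial_state (rho0e eps) (u0e eps) ord0 = rho0e eps.
    by apply/funext => p; rewrite /initial_state unlift_none.
  apply: le_trans (ler_norm Cr); rewrite -lee_fin; apply: le_trans Hr.
  exact: mass_le_L1 (rho0e_cont eps eps01).1.
have mass0 : 0 <= mass ((sol eps).1 t ord0).
  by apply: mass_ge0 => p; exact/ltW/Upos.
apply: le_trans (KP eps _ _ _ k eps01 M1 UC (Upos t ^~ t0)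
  (fun k p => UM t k p t0) (fun p => Urhs t k p t0)) _.
rewrite (gtr0_norm eps0) (ler_wpM2r (ltW eps0))//.
apply: (@le_trans _ _ (K * M ^+ 2 * `|Cr|)); last by rewrite lerDl.
apply: ler_pM => //; first by rewrite mulr_ge0// sqr_ge0.
apply: ler_wpM2l => //; rewrite ler_pXn2r ?nnegrE//.
- by apply: le_trans M1.
- by apply: le_trans MM; apply: le_trans M1.
Unshelve. all: by end_near. Qed.
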